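(* Let $A_S$ be an Artin group with presentation graph $\Gamma_S$, having the parabolic intersection property and the ribbon property. Then $A_S$ has a non-elementary acylindrical splitting arising as a visual splitting if and only if there exist two vertices $a$ and $b$ of $\Gamma_S$ whose neighbourhoods $N_{\Gamma_S}(a)$ and $N_{\Gamma_S}(b)$ are not joined by a path in $\Gamma_S$ with odd labels.
   Context: **Artin groups.** Let $\Gamma_S$ be a finite simple graph with vertex set $S$, each edge $\{u,v\}$ labelled by an integer $m_{uv}\ge 2$. The Artin group with presentation graph $\Gamma_S$ is $A_S=\langle S\mid \underbrace{uvu\cdots}_{m_{uv}}=\underbrace{vuv\cdots}_{m_{uv}},\ \{u,v\}\in E(\Gamma_S)\rangle$. For $X\subseteq S$, $\Gamma_X$ is the induced labelled subgraph, and the special subgroup $A_X$ is the subgroup generated by $X$ (it is naturally the Artin group of $\Gamma_X$, by van der Lek). A parabolic subgroup is a conjugate of a special subgroup. $A_S$ is spherical if its Coxeter group (add the relations $s^2=1$, $s\in S$) is finite. **Graph conventions.** $N_\Gamma(v)$ is $v$ together with all vertices adjacent to $v$ in $\Gamma$. A path with odd labels is a path all of whose edges have odd labels. Two sets of vertices are joined by such a path if one exists from a vertex of the first set to a vertex of the second; paths of length zero are allowed, so intersecting sets are joined. **Visual splittings.** A visual splitting of $A_S$ is an amalgam decomposition $A_S=A_X*_{A_Z}A_Y$ with $X,Y\subseteq S$, $X\cup Y=S$, $Z=X\cap Y$ (it exists exactly when no edge of $\Gamma_S$ joins $X\setminus Z$ to $Y\setminus Z$). **Acylindricity.** An action of a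 group $G$ on a simplicial tree $T$ (by simplicial isometries, without inversions) is acylindrical if there are integers $k\ge0$, $C>0$ such that the pointwise stabiliser of every edge path of length at least $k$ has at most $C$ elements. A splitting is a non-elementary acylindrical splitting if the action on its Bass--Serre tree is acylindrical with no global fixed point and no invariant line. **Parabolic intersection property (PIP).** $A_S$ has PIP if the intersection of any two parabolic subgroups of $A_S$ is parabolic. **Ribbon property (RP).** The Dynkin diagram $\overline\Gamma_S$ has vertex set $S$, with $u,v$ adjacent iff either $\{u,v\}\in E(\Gamma_S)$ with $m_{uv}>2$, or $\{u,v\}\notin E(\Gamma_S)$. For $X\subseteq S$, the irreducible components of $X$ are the vertex sets of the connected components of $\overline\Gamma_X$; $X_s$ (resp. $X_{as}$) is the union of those irreducible components $U$ with $A_U$ spherical (resp. non-spherical). Put $X^\perp=\{s\in S:\ \{s,t\}\in E(\Gamma_S)\text{ and } m_{st}=2\ \text{for all } t\in X\}$ (so $\emptyset^\perp=S$), and $X_{as}^\perp=(X_{as})^\perp$. If $A_U$ is spherical, $\Delta_U$ is the least common multiple of $U$ in the positive monoid $A_U^+$ with respect to left divisibility ($\Delta_\emptyset=1$). For $X,Y\subseteq S$, an element $g\in A_S$ is an elementary $(X,Y)$-ribbon if $gXg^{-1}=Y$ and there is $t\in S\setminus X$ such that the vertex set $U$ of the connected component of $\overline\Gamma_{X\cup\{t\}}$ containing $t$ generates a spherical subgroup and $g=\Delta_U^{-1}\Delta_{U\setminus\{t\}}$. Let $\operatorname{Conj}(S)$ be the groupoid whose objects are the subsets of $S$ and whose morphisms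 $X\to Y$ are the $g\in A_S$ with $gXg^{-1}=Y$, and let $\operatorname{Ribb}(S)$ be the smallest subgroupoid with the same objects containing all elementary ribbons; $\operatorname{Ribb}(S;X,Y)$ is the set of its morphisms $X\to Y$. For $S'\subseteq S$, $\operatorname{Ribb}(S';\cdot,\cdot)\subseteq A_{S'}$ is the same notion for $A_{S'}$. $A_S$ has RP if for all $X,Y\subseteq S$ and $g\in A_S$: $gA_Xg^{-1}\subseteq A_Y$ if and only if $X_{as}\subseteq Y$ and $g\in A_Y\cdot\operatorname{Ribb}(X_{as}^\perp;X_s,R)$ for some $R\subseteq Y$ (with $R\subseteq X_{as}^\perp$). *)

(* Defs.v *)
From HB Require Import structures.
From mathcomp Require Import all_boot.
From mathcomp Require Import boolp classical_sets functions cardinality.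
From mathcomp Require Import ssralg ssrint.

Set Implicit Arguments.
Unset Strict Implicit.
Unset Printing Implicit Defensive.

Local Open Scope classical_set_scope.
Local Open Scope quotient_scope.
Local Open Scope card_scope.
Local Open Scope group_scope.

Section PresentedMonoid.
Variables (T : choiceType) (R : seq T -> seq T -> Prop).

Inductive congr_words : seq T -> seq T -> Prop :=
| congr_rel u v of R u v : congr_words u v
| congr_refl u : congr_words u u
| congr_sym u v of congr_words u v : congr_words v u
| congr_trans v u w of congr_words u v & congr_words v w : congr_words u w
| congr_cat u1 v1 u2 v2 of congr_words u1 v1 & congr_words u2 v2 :
    congr_words (u1 ++ u2) (v1 ++ v2).

Definition congr_wordsb (u v : seq T) : bool := `[< congr_words u v >].

Lemma congr_wordsb_refl : reflexive congr_wordsb.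
Proof. by move=> u; apply/asboolP; apply: congr_refl. Qed.

Lemma congr_wordsb_sym : symmetric congr_wordsb.
Proof. by move=> u v; apply/asboolP/asboolP; apply: congr_sym. Qed.

Lemma congr_wordsb_trans : transitive congr_wordsb.
Proof.
by move=> v u w /asboolP uv /asboolP vw; apply/asboolP; apply: congr_trans vw.
Qed.

Canonical congr_words_equiv :=
  EquivRel congr_wordsb congr_wordsb_refl congr_wordsb_sym congr_wordsb_trans.

Definition pres_monoid : Type := {eq_quot congr_words_equiv}.

HB.instance Definition _ := Choice.on pres_monoid.
HB.instance Definition _ := EqQuotient.on pres_monoid.

Lemma pres_piP (u v : seq T) :
  \pi_pres_monoid u = \pi_pres_monoid v <-> congr_words u v.
Proof.
split=> [/eqmodP/asboolP //|uv]; by apply/eqmodP/asboolP.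
Qed.

Lemma pres_reprK (u : seq T) : congr_words (repr (\pi_pres_monoid u)) u.
Proof. by apply/pres_piP; rewrite reprK. Qed.

Definition pres_one : pres_monoid := \pi_pres_monoid [::].

Definition pres_mul (a b : pres_monoid) : pres_monoid :=
  \pi_pres_monoid (repr a ++ repr b).

Lemma pi_pres_mul (u v : seq T) :
  pres_mul (\pi_pres_monoid u) (\pi_pres_monoid v) = \pi_pres_monoid (u ++ v).
Proof. by apply/pres_piP; apply: congr_cat; apply: pres_reprK. Qed.

Lemma pres_mulA : associative pres_mul.
Proof.
elim/quotW=> u; elim/quotW=> v; elim/quotW=> w.
rewrite (pi_pres_mul v w) (pi_pres_mul u v).
by rewrite (pi_pres_mul u (v ++ w)) (pi_pres_mul (u ++ v) w) catA.
Qed.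

Lemma pres_mul1g : left_id pres_one pres_mul.
Proof. by elim/quotW=> u; rewrite pi_pres_mul. Qed.

Lemma pres_mulg1 : right_id pres_one pres_mul.
Proof. by elim/quotW=> u; rewrite pi_pres_mul cats0. Qed.

HB.instance Definition _ :=
  isMonoid.Build pres_monoid pres_mulA pres_mul1g pres_mulg1.

End PresentedMonoid.

(* In group words, the letter (s, true) stands for s and (s, false) for s^-1. *)
Section PresentedGroup.
Variables (T : choiceType) (R : seq T -> seq T -> Prop).

Definition pos_word (u : seq T) : seq (T * bool) := [seq (s, true) | s <- u].

Inductive group_rel : seq (T * bool) -> seq (T * bool) -> Prop :=
| group_rel_cancel s b : group_rel [:: (s, b); (s, ~~ b)] [::]
| group_rel_pos u v of R u v : group_rel (pos_word u) (pos_word v).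

Definition pres_group : Type := pres_monoid group_rel.

HB.instance Definition _ := Monoid.on pres_group.
HB.instance Definition _ := EqQuotient.on pres_group.

Definition inv_word (u : seq (T * bool)) : seq (T * bool) :=
  rev [seq (x.1, ~~ x.2) | x <- u].

Lemma inv_wordK : involutive inv_word.
Proof.
move=> u; rewrite /inv_word map_rev revK -map_comp -[RHS]map_id.
by apply: eq_map => -[s b] /=; rewrite negbK.
Qed.

Lemma cat_inv_word u : congr_words group_rel (u ++ inv_word u) [::].
Proof.
elim: u => [|[s b] u IH]; first exact: congr_refl.
rewrite /inv_word /= rev_cons -/(inv_word u) -cats1.
apply: (congr_trans (v := [:: (s, b)] ++ [::] ++ [:: (s, ~~ b)])).
  rewrite -[X in congr_words _ X _]cat1s; apply: congr_cat; first exact: congr_refl.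
  by rewrite catA; apply: congr_cat => //; apply: congr_refl.
by apply: congr_rel; apply: group_rel_cancel.
Qed.

Lemma cat_word_inv u : congr_words group_rel (inv_word u ++ u) [::].
Proof. by rewrite -{2}[u]inv_wordK; apply: cat_inv_word. Qed.

Lemma congr_inv_word u v :
  congr_words group_rel u v -> congr_words group_rel (inv_word u) (inv_word v).
Proof.
move=> uv; apply: (congr_trans (v := inv_word u ++ (v ++ inv_word v))).
  rewrite -{1}[inv_word u]cats0; apply: congr_cat; first exact: congr_refl.
  exact/congr_sym/cat_inv_word.
apply: (congr_trans (v := (inv_word u ++ u) ++ inv_word v)).
  rewrite catA; apply: congr_cat; last exact: congr_refl.
  by apply: congr_cat; [apply: congr_refl | apply: congr_sym].
rewrite -[X in congr_words _ _ X]cat0s.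
by apply: congr_cat; [apply: cat_word_inv | apply: congr_refl].
Qed.

Definition pres_inv (a : pres_group) : pres_group :=
  \pi_pres_group (inv_word (repr a)).

HB.instance Definition _ := hasInv.Build pres_group pres_inv.

Lemma pi_pres_inv u : (\pi_pres_group u)^-1 = \pi_pres_group (inv_word u).
Proof. by apply/pres_piP/congr_inv_word/pres_reprK. Qed.

Lemma pi_pres_groupM u v :
  \pi_pres_group u * \pi_pres_group v = \pi_pres_group (u ++ v).
Proof. exact: pi_pres_mul. Qed.

Lemma pres_mulVg :
  left_inverse 1 (fun a : pres_group => a^-1) (fun a b => a * b).
Proof.
elim/quotW=> u; rewrite pi_pres_inv pi_pres_groupM.
exact/pres_piP/cat_word_inv.
Qed.

Lemma pres_mulgV :
  right_inverse 1 (fun a : pres_group => a^-1) (fun a b => a * b).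
Proof.
elim/quotW=> u; rewrite pi_pres_inv pi_pres_groupM.
exact/pres_piP/cat_inv_word.
Qed.

HB.instance Definition _ := Monoid_isGroup.Build pres_group pres_mulVg pres_mulgV.

Definition pres_gen (s : T) : pres_group := \pi_pres_group [:: (s, true)].

End PresentedGroup.

Section Subgroups.
Variable gT : groupType.
Implicit Types (A H K L : set gT) (g : gT).

Definition is_subgroup H : Prop :=
  [/\ H 1, (forall x y, H x -> H y -> H (x * y)) & forall x, H x -> H x^-1].

Definition generated A : set gT := smallest is_subgroup A.

(* [conj_set g A] is g A g^-1, whereas MathComp's [x ^ g] is g^-1 x g. *)
Definition conj_set g A : set gT := [set g * x * g^-1 | x in A].

Definition lcoset_set g H : set gT := [set g * x | x in H].

Definition morph_on (hT : groupType) H (f : gT -> hT) : Prop :=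
  forall x y, H x -> H y -> f (x * y) = f x * f y.

(* gT is the amalgamated product H *_L K of its subgroups H and K over L: it is
   the pushout of the inclusions of L into H and K. *)
Definition is_amalgam H K L : Prop :=
  [/\ L `<=` H, L `<=` K &
  forall (hT : groupType) (f1 f2 : gT -> hT),
    morph_on H f1 -> morph_on K f2 -> (forall x, L x -> f1 x = f2 x) ->
    let extends (phi : gT -> hT) :=
      [/\ {morph phi : x y / x * y},
          forall x, H x -> phi x = f1 x & forall x, K x -> phi x = f2 x] in
    exists2 phi, extends phi & forall psi, extends psi -> psi =1 phi].

Definition left_cosets H : Type := {C : set gT | exists g, C = lcoset_set g H}.

Lemma lcoset_set1 A : lcoset_set 1 A = A.
Proof.
apply/seteqP; split=> [_ [x Ax <-]|x Ax]; first by rewrite mul1g.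
by exists x; rewrite ?mul1g.
Qed.

Lemma lcoset_setM g h A : lcoset_set (g * h) A = lcoset_set g (lcoset_set h A).
Proof.
apply/seteqP; split=> [_ [x Ax <-]|_ [_ [x Ax <-] <-]].
  by exists (h * x); [exists x | rewrite mulgA].
by exists x; rewrite ?mulgA.
Qed.

Lemma lcoset_setS g A B : A `<=` B -> lcoset_set g A `<=` lcoset_set g B.
Proof. by move=> AB _ [x Ax <-]; exists x => //; apply: AB. Qed.

Lemma lcoset_act_subproof H g (C : left_cosets H) :
  exists h, lcoset_set g (sval C) = lcoset_set h H.
Proof. by case: C => _ /= [h ->]; exists (g * h); rewrite lcoset_setM. Qed.

Definition lcoset_act H g (C : left_cosets H) : left_cosets H :=
  exist _ (lcoset_set g (sval C)) (lcoset_act_subproof g C).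

Lemma left_cosets_inj H (C D : left_cosets H) : sval C = sval D -> C = D.
Proof. by move=> CD; apply: eq_sig_hprop => // *; apply: Prop_irrelevance. Qed.

Lemma lcoset_act1 H (C : left_cosets H) : lcoset_act 1 C = C.
Proof. by apply: left_cosets_inj; apply: lcoset_set1. Qed.

Lemma lcoset_actM H g h (C : left_cosets H) :
  lcoset_act (g * h) C = lcoset_act g (lcoset_act h C).
Proof. by apply: left_cosets_inj; apply: lcoset_setM. Qed.

End Subgroups.

Record graph_action (gT : groupType) := GraphAction {
  ga_vertex : Type;
  ga_adj : ga_vertex -> ga_vertex -> Prop;
  ga_act : gT -> ga_vertex -> ga_vertex;
  ga_adj_sym : forall v w, ga_adj v w -> ga_adj w v;
  ga_adj_irr : forall v, ~ ga_adj v v;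
  ga_act1 : forall v, ga_act 1 v = v;
  ga_actM : forall g h v, ga_act (g * h) v = ga_act g (ga_act h v);
  ga_act_adj : forall g v w, ga_adj v w -> ga_adj (ga_act g v) (ga_act g w) }.

Section GraphActions.
Variables (gT : groupType) (T : graph_action gT).

(* p 0, ..., p n are the successive vertices of an edge path of length n. The
   vertices are distinct: edge paths in a tree are taken without backtracking. *)
Definition edge_path (n : nat) (p : nat -> ga_vertex T) : Prop :=
  (forall i, i < n -> ga_adj (p i) (p i.+1)) /\
  (forall i j, i <= n -> j <= n -> p i = p j -> i = j).

Definition path_stabiliser (n : nat) (p : nat -> ga_vertex T) : set gT :=
  [set g | forall i, i <= n -> ga_act g (p i) = p i].

Definition acylindrical : Prop :=
  exists k C : nat, 0 < C /\
    forall n p, k <= n -> edge_path n p -> path_stabiliser n p #<= `I_C.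

(* The actions considered are without inversions, so fixing a point of the
   geometric realisation amounts to fixing a vertex. *)
Definition has_global_fixed_point : Prop :=
  exists v : ga_vertex T, forall g, ga_act g v = v.

Definition has_invariant_line : Prop :=
  exists l : int -> ga_vertex T,
    [/\ injective l, forall i, ga_adj (l i) (l (i + 1)%R) &
        forall g, ga_act g @` range l = range l].

Definition nonelementary_acylindrical : Prop :=
  [/\ acylindrical, ~ has_global_fixed_point & ~ has_invariant_line].

End GraphActions.

(* The Bass-Serre tree of an amalgam H *_L K: its vertices are the left cosets
   of H and of K, and each left coset gL is an edge from gH to gK. The graph is
   simplicial because an amalgam satisfies L = H `&` K, so that the ends of an
   edge gL determine it: gL = gH `&` gK. *)
Section BassSerre.
Variables (gT : groupType) (H K L : set gT).

Definition bs_vertex : Type := (left_cosets H + left_cosets K)%type.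

Definition bs_edge (C : left_cosets H) (D : left_cosets K) : Prop :=
  exists E : left_cosets L, sval E `<=` sval C /\ sval E `<=` sval D.

Definition bs_adj (v w : bs_vertex) : Prop :=
  match v, w with
  | inl C, inr D | inr D, inl C => bs_edge C D
  | _, _ => False
  end.

Definition bs_act (g : gT) (v : bs_vertex) : bs_vertex :=
  match v with
  | inl C => inl (lcoset_act g C)
  | inr D => inr (lcoset_act g D)
  end.

Lemma bs_adj_sym v w : bs_adj v w -> bs_adj w v.
Proof. by case: v w => [C|D] [C'|D']. Qed.

Lemma bs_adj_irr v : ~ bs_adj v v.
Proof. by case: v => C; case. Qed.

Lemma bs_act1 v : bs_act 1 v = v.
Proof. by case: v => C /=; rewrite lcoset_act1. Qed.

Lemma bs_actM g h v : bs_act (g * h) v = bs_act g (bs_act h v).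
Proof. by case: v => C /=; rewrite lcoset_actM. Qed.

Lemma bs_act_edge g C D :
  bs_edge C D -> bs_edge (lcoset_act g C) (lcoset_act g D).
Proof.
by move=> [E [EC ED]]; exists (lcoset_act g E); split; apply: lcoset_setS.
Qed.

Lemma bs_act_adj g v w : bs_adj v w -> bs_adj (bs_act g v) (bs_act g w).
Proof. by case: v w => [C|D] [C'|D'] //=; apply: bs_act_edge. Qed.

Definition bass_serre_tree : graph_action gT :=
  GraphAction bs_adj_sym bs_adj_irr bs_act1 bs_actM bs_act_adj.

End BassSerre.

(* Only the values of [label] on edges are meaningful. *)
Record labelled_graph := LabelledGraph {
  vertex :> finType;
  edge : rel vertex;
  label : vertex -> vertex -> nat;
  edge_sym : symmetric edge;
  edge_irr : irreflexive edge;
  label_sym : forall u v, edge u v -> label u v = label v u;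
  label_ge2 : forall u v, edge u v -> 2 <= label u v }.

Fixpoint alt_word (T : Type) (n : nat) (u v : T) : seq T :=
  if n is n'.+1 then u :: alt_word n' v u else [::].

Section ArtinGroups.
Variable G : labelled_graph.

Inductive braid_rel : seq G -> seq G -> Prop :=
| BraidRel (u v : G) of edge u v :
    braid_rel (alt_word (label u v) u v) (alt_word (label u v) v u).

Inductive coxeter_rel : seq G -> seq G -> Prop :=
| CoxeterBraid u v of braid_rel u v : coxeter_rel u v
| CoxeterSquare (s : G) : coxeter_rel [:: s; s] [::].

Definition artin_monoid : monoidType := pres_monoid braid_rel.
Definition artin_group : groupType := pres_group braid_rel.
Definition coxeter_group : groupType := pres_group coxeter_rel.

Definition agen (s : G) : artin_group := pres_gen braid_rel s.
Definition mgen (s : G) : artin_monoid := \pi_(pres_monoid braid_rel) [:: s].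

Definition spherical_graph : Prop := finite_set [set: coxeter_group].

End ArtinGroups.

Section Induced.
Variables (G : labelled_graph) (X : {set G}).

Let V : finType := {x : G | x \in X}.

Fact ind_edge_sym : symmetric (fun u v : V => edge (val u) (val v)).
Proof. by move=> u v; apply: edge_sym. Qed.

Fact ind_edge_irr : irreflexive (fun u v : V => edge (val u) (val v)).
Proof. by move=> u; apply: edge_irr. Qed.

Fact ind_label_sym (u v : V) :
  edge (val u) (val v) -> label (val u) (val v) = label (val v) (val u).
Proof. exact: label_sym. Qed.

Fact ind_label_ge2 (u v : V) :
  edge (val u) (val v) -> 2 <= label (val u) (val v).
Proof. exact: label_ge2. Qed.

Definition induced : labelled_graph :=
  LabelledGraph ind_edge_sym ind_edge_irr ind_label_sym ind_label_ge2.

End Induced.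

Section ArtinNotions.
Variable G : labelled_graph.
Local Notation A_S := (artin_group G).
Implicit Types (X Y Z U W : {set G}) (g : A_S).

Definition gens X : set A_S := @agen G @` [set` X].

Definition special X : set A_S := generated (gens X).

Definition parabolic (P : set A_S) : Prop :=
  exists g X, P = conj_set g (special X).

Definition PIP : Prop :=
  forall P Q, parabolic P -> parabolic Q -> parabolic (P `&` Q).

Definition visual_splitting X Y : Prop :=
  (X :|: Y = finset.setT)%SET /\
  is_amalgam (special X) (special Y) (special (X :&: Y)%SET).

Definition visual_tree X Y : graph_action A_S :=
  bass_serre_tree (special X) (special Y) (special (X :&: Y)%SET).

Definition spherical U : Prop := spherical_graph (induced U).

Definition dynkin : rel G :=
  fun u v => (u != v) && (edge u v ==> (2 < label u v)).

Definition dynkin_in X : rel G :=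
  fun u v => [&& u \in X, v \in X & dynkin u v].

Definition component X (t : G) : {set G} :=
  [set u in X | connect (dynkin_in X) t u]%SET.

Definition irr_components X : {set {set G}} :=
  [set component X t | t in X]%SET.

Definition sph_part X : {set G} :=
  (\bigcup_(U in irr_components X | `[< spherical U >]) U)%SET.

Definition asph_part X : {set G} :=
  (\bigcup_(U in irr_components X | ~~ `[< spherical U >]) U)%SET.

Definition perp X : {set G} :=
  [set s | [forall t in X, edge s t && (label s t == 2)]]%SET.

(* The homomorphism from the positive monoid A_U^+ to A_S. *)
Definition monoid_to_group U (d : artin_monoid (induced U)) : A_S :=
  \prod_(s <- repr (d : pres_monoid (@braid_rel (induced U)))) agen (val s).

Lemma monoid_to_groupE U (w : seq {x : G | x \in U}) :
  monoid_to_group (\pi_(pres_monoid (@braid_rel (induced U))) w) =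
  \prod_(s <- w) agen (val s).
Proof.
have alt_val n (u v : {x : G | x \in U}) :
    [seq val s | s <- alt_word n u v] = alt_word n (val u) (val v).
  by elim: n u v => //= n IH u v; rewrite IH.
have prod_pos (u : seq G) :
    \prod_(s <- u) agen s = \pi_(pres_group (@braid_rel G)) (pos_word u).
  elim: u => [|s u IH]; first by rewrite big_nil.
  by rewrite big_cons IH /agen /pres_gen [LHS]pi_pres_groupM.
suff prodE u v : congr_words (@braid_rel (induced U)) u v ->
    \prod_(s <- u) agen (val s) = \prod_(s <- v) agen (val s) :> A_S.
  exact/prodE/pres_reprK.
elim=> // {u v} [_ _ [u v uv]|v1 u1 w1 _ -> _ ->|u1 v1 u2 v2 _ IH1 _ IH2] //.
  rewrite -!(big_map val predT (fun s : G => agen s)) !alt_val !prod_pos.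
  by apply/pres_piP/congr_rel/group_rel_pos; apply: BraidRel.
by rewrite !big_cat; congr (_ * _).
Qed.

Lemma monoid_to_groupM U : {morph @monoid_to_group U : d e / d * e}.
Proof.
elim/quotW=> u; elim/quotW=> v.
by rewrite [X in monoid_to_group X]pi_pres_mul !monoid_to_groupE big_cat.
Qed.

Definition ldvd (M : monoidType) (a b : M) : Prop := exists c, b = a * c.

Definition is_lcm (M : monoidType) (A : set M) (d : M) : Prop :=
  (forall a, A a -> ldvd a d) /\
  (forall e, (forall a, A a -> ldvd a e) -> ldvd d e).

(* d is the image in A_S of Delta_U, the lcm of U in A_U^+ for left divisibility. *)
Definition is_Delta U (d : A_S) : Prop :=
  exists2 e : artin_monoid (induced U),
    is_lcm (range (@mgen (induced U))) e & d = monoid_to_group e.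

(* Ribbons are taken in the special subgroup A_W of A_S; the case W = S is the
   plain notion. *)
Definition elementary_ribbon W X Y g : Prop :=
  [/\ X \subset W, Y \subset W, conj_set g (gens X) = gens Y &
  exists t, [/\ t \in W, t \notin X &
    let U := component (t |: X)%SET t in
    spherical U /\
    exists d d', [/\ is_Delta U d, is_Delta (U :\ t)%SET d' & g = d^-1 * d']]].

Inductive Ribb W : {set G} -> {set G} -> A_S -> Prop :=
| Ribb_elementary X Y g of elementary_ribbon W X Y g : Ribb W X Y g
| Ribb_id X of X \subset W : Ribb W X X 1
| Ribb_comp X Y Z g h of Ribb W X Y g & Ribb W Y Z h : Ribb W X Z (h * g)
| Ribb_inv X Y g of Ribb W X Y g : Ribb W Y X g^-1.

Definition RP : Prop :=
  forall X Y g,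
    conj_set g (special X) `<=` special Y <->
    asph_part X \subset Y /\
    exists (R : {set G}) (y r : A_S),
      [/\ R \subset Y, R \subset perp (asph_part X), special Y y,
          Ribb (perp (asph_part X)) (sph_part X) R r & g = y * r].

Definition nbhd (v : G) : {set G} := (v |: [set u | edge v u])%SET.

Definition odd_edge : rel G := fun u v => edge u v && odd (label u v).

Definition joined_by_odd_path (A B : {set G}) : Prop :=
  exists u v, [/\ u \in A, v \in B & connect odd_edge u v].

End ArtinNotions.

(* Main.v *)
Require Import Defs.
From mathcomp Require Import all_boot.
From HB Require Import structures.
From mathcomp Require Import boolp classical_sets functions cardinality.
From mathcomp Require Import order ssralg ssrnum ssrint poly zmodp algC cyclotomic ring zify.

(* If nbhd a and nbhd b are not joined by an odd path, take X = S \ {b} and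
   Y = S \ {a}. By PIP the stabiliser of a path of length 3 is parabolic; if it is
   not trivial it contains a conjugate g w g^-1 of a generator. The odd class of
   w misses nbhd a, say, and then every ribbon starting at w avoids the letter a,
   so by RP the coset g A_Y is the only coset of A_Y fixed by g w g^-1, whereas
   the path contains two of them.

   Conversely, if all neighbourhoods are joined, an odd path from nbhd a, with a
   outside Y, to nbhd b, with b outside X, yields a generator u in X :&: Y
   commuting with some h1 in A_X \ A_Y and some h2 in A_Y \ A_X (conjugates of
   powers (x u)^m for edges x-u). Then u fixes the axis of h1 h2 pointwise.

   The only structural inputs on Artin groups are facts such as: u is not in A_Z
   and (u w)^m is not in A_Z when u is not in Z; they are read off a Burau-type
   deformation of the reflection representation. *)

Set Implicit Arguments.
Unset Strict Implicit.
Unset Printing Implicit Defensive.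

(** * Permutation groups, the targets of the actions built below *)

Section SymmetricGroup.
Local Open Scope group_scope.
Variable T : Type.

(** Carrying the inverse map as data makes the group operations reduce definitionally; by
    [eq_bijection], equality still depends on the forward map only. *)
Record bijection := Bijection {
  bij_fun :> T -> T;
  bij_inv : T -> T;
  bij_funK : cancel bij_fun bij_inv;
  bij_invK : cancel bij_inv bij_fun }.

HB.instance Definition _ := gen_eqMixin bijection.
HB.instance Definition _ := gen_choiceMixin bijection.

Lemma eq_bijection (f g : bijection) : f =1 g -> f = g.
Proof.
case: f g => f f' fK f'K [g g' gK g'K] /= fg.
have efg : f = g by apply: funext.
have efg' : f' = g' by apply: funext => x; rewrite -{1}[x]g'K -fg fK.
case: _ / efg in gK g'K fg *; case: _ / efg' in gK g'K fg *.
by congr Bijection; apply: Prop_irrelevance.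
Qed.

Definition bij_one : bijection := @Bijection id id (fun=> erefl) (fun=> erefl).
Definition bij_mul (f g : bijection) : bijection :=
  Bijection (can_comp (@bij_funK f) (@bij_funK g)) (can_comp (@bij_invK g) (@bij_invK f)).
Definition bij_opp (f : bijection) : bijection := Bijection (@bij_invK f) (@bij_funK f).

Lemma bij_mulA : associative bij_mul. Proof. by move=> f g h; apply: eq_bijection. Qed.
Lemma bij_mul1g : left_id bij_one bij_mul. Proof. by move=> f; apply: eq_bijection. Qed.
Lemma bij_mulg1 : right_id bij_one bij_mul. Proof. by move=> f; apply: eq_bijection. Qed.
Lemma bij_mulVg : left_inverse bij_one bij_opp bij_mul.
Proof. by move=> f; apply: eq_bijection => x /=; rewrite bij_funK. Qed.
Lemma bij_mulgV : right_inverse bij_one bij_opp bij_mul.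
Proof. by move=> f; apply: eq_bijection => x /=; rewrite bij_invK. Qed.

HB.instance Definition _ :=
  isGroup.Build bijection bij_mulA bij_mul1g bij_mulg1 bij_mulVg bij_mulgV.

Lemma bijM (f g : bijection) x : (f * g) x = f (g x). Proof. by []. Qed.
Lemma bij1 x : (1 : bijection) x = x. Proof. by []. Qed.

End SymmetricGroup.

(** * Morphisms and generated subgroups *)

Section Morphisms.
Local Open Scope classical_set_scope.
Local Open Scope group_scope.
Variables gT hT : groupType.
Implicit Types (f : gT -> hT).

Lemma morph1 f : {morph f : x y / x * y} -> f 1 = 1.
Proof. by move=> fM; apply: (mulgI (f 1)); rewrite -fM !mulg1. Qed.

Lemma morphV f : {morph f : x y / x * y} -> {morph f : x / x^-1}.
Proof.
by move=> fM x; apply: (mulgI (f x)); rewrite -fM !mulgV; apply: morph1.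
Qed.

Lemma morphX f n : {morph f : x y / x * y} -> {morph f : x / x ^+ n}.
Proof.
by move=> fM x; elim: n => [|n IH]; [rewrite !expg0; apply: morph1 | rewrite !expgS fM IH].
Qed.

End Morphisms.

Section Generation.
Local Open Scope classical_set_scope.
Local Open Scope group_scope.
Variable gT : groupType.
Implicit Types (A H : set gT).

Lemma is_subgroup_generated A : is_subgroup (generated A).
Proof.
split=> [H [[]]//|x y Ax Ay H HA|x Ax H HA].
  by have [[_ HM _] _] := HA; apply: HM; [apply: Ax | apply: Ay].
by have [[_ _ HV] _] := HA; apply: HV; apply: Ax.
Qed.

Lemma sub_generated A : A `<=` generated A.
Proof. by move=> x Ax H [_]; apply. Qed.

Lemma generated_min A H : is_subgroup H -> A `<=` H -> generated A `<=` H.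
Proof. by move=> sH AH x; apply. Qed.

Lemma generatedS A B : A `<=` B -> generated A `<=` generated B.
Proof.
move=> AB; apply: generated_min; first exact: is_subgroup_generated.
exact: (subset_trans AB (@sub_generated B)).
Qed.

(** Multiplicativity is assumed on [H] only, as in [is_amalgam], so the values at 1 and at inverses
    are computed inside [H]. This is what lets equality on generators propagate. *)
Lemma subgroup_equalizer (hT : groupType) H (f1 f2 : gT -> hT) :
  is_subgroup H -> morph_on H f1 -> morph_on H f2 ->
  is_subgroup [set x | H x /\ f1 x = f2 x].
Proof.
move=> [H1 HM HV] f1M f2M.
have e1 f : morph_on H f -> f 1 = 1.
  by move=> fM; apply: (mulgI (f 1)); rewrite -fM // !mulg1.
have eV f x : morph_on H f -> H x -> f x^-1 = (f x)^-1.
  move=> fM Hx; apply: (mulgI (f x)); rewrite -fM ?mulgV ?e1 //; exact: HV.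
split=> [|x y [Hx ex] [Hy ey]|x [Hx ex]].
- by split=> //; rewrite !e1.
- by split; [apply: HM | rewrite f1M // f2M // ex ey].
- by split; [apply: HV | rewrite !eV // ex].
Qed.

End Generation.

(** * Universal property of presented groups *)

Section Lift.
Local Open Scope group_scope.
Local Open Scope quotient_scope.
Variables (T : choiceType) (R : seq T -> seq T -> Prop).

Lemma pres_group_ind (P : pres_group R -> Prop) :
  P 1 -> (forall s g, P g -> P (pres_gen R s * g)) ->
  (forall s g, P g -> P ((pres_gen R s)^-1 * g)) -> forall g, P g.
Proof.
move=> P1 PM PV; elim/quotW; elim=> [|[s b] u IH]; first exact: P1.
rewrite -cat1s -[X in P X]pi_pres_groupM.
case: b; first exact: PM.
suff -> : \pi_(pres_group R) [:: (s, false)] = (pres_gen R s)^-1 by apply: PV.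
by rewrite /pres_gen pi_pres_inv.
Qed.

Lemma pres_gen_prod (u : seq T) :
  \prod_(s <- u) pres_gen R s = \pi_(pres_group R) (pos_word u).
Proof.
elim: u => [|s u IH]; first by rewrite big_nil.
by rewrite big_cons IH /pres_gen [LHS]pi_pres_groupM.
Qed.

Lemma pres_gen_rel u v : R u v ->
  \prod_(s <- u) pres_gen R s = \prod_(s <- v) pres_gen R s.
Proof.
by move=> uv; rewrite !pres_gen_prod; apply/pres_piP/congr_rel/group_rel_pos.
Qed.

Lemma pres_group_lift (hT : groupType) (f : T -> hT) :
  (forall u v, R u v -> \prod_(s <- u) f s = \prod_(s <- v) f s) ->
  exists2 phi : pres_group R -> hT,
    {morph phi : x y / x * y} & forall s, phi (pres_gen R s) = f s.
Proof.
move=> fR; pose fb (x : T * bool) := if x.2 then f x.1 else (f x.1)^-1.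
pose ev u := \prod_(x <- u) fb x.
have evR u v : congr_words (group_rel R) u v -> ev u = ev v.
  elim=> // {u v} [_ _ [s b|u v uv]|u w v _ -> _ ->|u1 v1 u2 v2 _ IH1 _ IH2] //.
  - rewrite /ev !big_cons big_nil mulg1 /fb /=.
    by case: b; rewrite ?mulgV ?mulVg.
  - by rewrite /ev !big_map; apply: fR.
  - by rewrite /ev !big_cat; congr (_ * _).
have evpi u : ev (repr (\pi_(pres_group R) u)) = ev u by apply/evR/pres_reprK.
exists (fun g => ev (repr g)) => [|s].
  elim/quotW=> u; elim/quotW=> v.
  by rewrite pi_pres_groupM !evpi /ev big_cat.
by rewrite evpi /ev big_cons big_nil mulg1.
Qed.

End Lift.

(** * Alternating products and braid relations in a group *)

Section AltProd.
Local Open Scope group_scope.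
Variable gT : groupType.
Implicit Types x y : gT.

Definition alt_prod n x y : gT := \prod_(s <- alt_word n x y) s.

Lemma alt_prodS n x y : alt_prod n.+1 x y = x * alt_prod n y x.
Proof. by rewrite /alt_prod big_cons. Qed.

Lemma alt_prod_double n x y : alt_prod n.*2 x y = (x * y) ^+ n.
Proof.
elim: n => [|n IH]; first by rewrite /alt_prod big_nil.
by rewrite doubleS !alt_prodS IH mulgA -expgS.
Qed.

Lemma alt_prodD m n x y :
  alt_prod (m + n) x y =
  alt_prod m x y * (if odd m then alt_prod n y x else alt_prod n x y).
Proof.
elim: m x y => [|m IH] x y; first by rewrite /alt_prod big_nil mul1g.
by rewrite addSn !alt_prodS IH /= mulgA; case: (odd m).
Qed.

Lemma alt_prod1 x y : alt_prod 1 x y = x.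
Proof. by rewrite alt_prodS /alt_prod big_nil mulg1. Qed.

Lemma alt_prod_comm n x y : x * y = y * x -> ~~ odd n -> alt_prod n x y = alt_prod n y x.
Proof. by move=> xy /even_halfK <-; rewrite !alt_prod_double xy. Qed.

Lemma prod_alt_word (T : Type) (f : T -> gT) n u v :
  \prod_(s <- alt_word n u v) f s = alt_prod n (f u) (f v).
Proof.
elim: n u v => [|n IH] u v; first by rewrite /alt_prod !big_nil.
by rewrite big_cons IH alt_prodS.
Qed.

Section BraidRelation.
Variables (m : nat) (x y : gT).
Hypothesis braid : alt_prod m x y = alt_prod m y x.

(** Both powers are alternating products of length [2m]; the relation exchanges [x] and [y] in each
    half. *)
Lemma braid_pow : (x * y) ^+ m = (y * x) ^+ m.
Proof.
by rewrite -!alt_prod_double -addnn !alt_prodD braid; case: (odd m); rewrite ?braid.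
Qed.

(** By [braid_pow] the left side is [x (yx)^m], the same alternating word of length [2m + 1] as the
    right side. *)
Lemma braid_pow_commute : x * (x * y) ^+ m = (x * y) ^+ m * x.
Proof.
rewrite {1}braid_pow -!alt_prod_double -alt_prodS -addn1 alt_prodD odd_double.
by rewrite alt_prod1.
Qed.

(** Both sides are alternating of length [m + 1]. This is what carries centralising elements along
    odd edges. *)
Lemma braid_odd_conj : odd m -> x * alt_prod m x y = alt_prod m x y * y.
Proof. by move=> om; rewrite {1}braid -alt_prodS -addn1 alt_prodD om alt_prod1. Qed.

End BraidRelation.
End AltProd.

(** * Special subgroups of Artin groups and visual amalgams *)

Section ArtinBasics.
Local Open Scope classical_set_scope.
Local Open Scope group_scope.
Variable G : labelled_graph.
Implicit Types (X Y : {set G}).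

Lemma agen_braid (u v : G) : edge u v ->
  alt_prod (label u v) (agen u) (agen v) = alt_prod (label u v) (agen v) (agen u).
Proof.
move=> uv; rewrite -!prod_alt_word.
exact: (@pres_gen_rel _ (@braid_rel G) _ _ (BraidRel uv)).
Qed.

Lemma artin_lift (hT : groupType) (f : G -> hT) :
  (forall u v, edge u v ->
     alt_prod (label u v) (f u) (f v) = alt_prod (label u v) (f v) (f u)) ->
  exists2 phi : artin_group G -> hT,
    {morph phi : x y / x * y} & forall s, phi (agen s) = f s.
Proof.
move=> fB; apply: (@pres_group_lift G (@braid_rel G) hT f) => _ _ [u v uv].
by rewrite !prod_alt_word fB.
Qed.

Lemma special_subgroup X : is_subgroup (special X).
Proof. exact: is_subgroup_generated. Qed.

Lemma special1 X : special X 1.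
Proof. by have [] := special_subgroup X. Qed.

Lemma specialM X x y : special X x -> special X y -> special X (x * y).
Proof. by have [_ + _] := special_subgroup X; apply. Qed.

Lemma specialV X x : special X x -> special X x^-1.
Proof. by have [_ _] := special_subgroup X; apply. Qed.

Lemma specialX X x n : special X x -> special X (x ^+ n).
Proof.
by move=> Xx; elim: n => [|n IH]; rewrite ?expg0 ?expgS; [apply: special1 | apply: specialM].
Qed.

Lemma special_agen X s : s \in X -> special X (agen s).
Proof. by move=> Xs; apply: sub_generated; exists s. Qed.

Lemma special_alt_prod X n x y : special X x -> special X y -> special X (alt_prod n x y).
Proof.
elim: n x y => [|n IH] x y Xx Xy; first by rewrite /alt_prod big_nil; apply: special1.
by rewrite alt_prodS; apply: specialM => //; apply: IH.
Qed.

Lemma specialS X Y : X \subset Y -> special X `<=` special Y.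
Proof. by move=> /fintype.subsetP XY; apply: generatedS => _ [s /= /XY Ys <-]; exists s. Qed.

Lemma special_min X H : is_subgroup H -> (forall s, s \in X -> H (agen s)) ->
  special X `<=` H.
Proof. by move=> sH XH; apply: generated_min => // _ [s Xs <-]; apply: XH. Qed.

Lemma specialT g : special (finset.setT : {set G}) g.
Proof.
elim/(@pres_group_ind G (@braid_rel G)): g => [|s g IH|s g IH]; first exact: special1.
  by apply: specialM IH; apply: special_agen; exact: finset.in_setT.
by apply: specialM IH; apply: specialV; apply: special_agen; exact: finset.in_setT.
Qed.

Lemma special0 : special (finset.set0 : {set G}) `<=` [set 1].
Proof.
apply: special_min => [|s]; last by rewrite finset.in_set0.
split=> [//|x y /= -> ->|x /= ->]; [exact: mulg1 | exact: invg1].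
Qed.

(* Morphisms on the special subgroups are glued on generators, since every edge
   lies in X or in Y. *)
Lemma special_amalgam X Y :
  (X :|: Y = finset.setT)%SET ->
  (forall u v, u \notin Y -> v \notin X -> ~~ edge u v) ->
  visual_splitting X Y.
Proof.
move=> XYT noedge; have covers s : (s \in X) || (s \in Y).
  by have := finset.in_setT s; rewrite -XYT finset.in_setU.
split=> //; split=> [||hT f1 f2 f1M f2M f12].
- apply: specialS; exact: finset.subsetIl.
- apply: specialS; exact: finset.subsetIr.
pose f s := if s \in X then f1 (agen s) else f2 (agen s).
have fX s : s \in X -> f s = f1 (agen s) by rewrite /f => ->.
have fY s : s \in Y -> f s = f2 (agen s).
  move=> Ys; rewrite /f; case: ifP => // Xs.
  by rewrite f12 //; apply: special_agen; rewrite finset.in_setI Xs.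
have alt_on Z (h : artin_group G -> hT) n u v : morph_on (special Z) h ->
    u \in Z -> v \in Z -> 0 < n ->
    h (alt_prod n (agen u) (agen v)) = alt_prod n (h (agen u)) (h (agen v)).
  move=> hM; case: n => // n Zu Zv _; elim: n u v Zu Zv => [|n IH] u v Zu Zv.
    by rewrite !alt_prod1.
  have Zau := special_agen Zu; have Zav := special_agen Zv.
  have Zw := special_alt_prod n.+1 Zav Zau.
  by rewrite alt_prodS hM // IH // -alt_prodS.
have fB u v : edge u v ->
    alt_prod (label u v) (f u) (f v) = alt_prod (label u v) (f v) (f u).
  move=> uv; have m_gt0 : 0 < label u v by apply: leq_trans (label_ge2 uv).
  have on Z h : morph_on (special Z) h -> u \in Z -> v \in Z ->
      (forall s, s \in Z -> f s = h (agen s)) ->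
      alt_prod (label u v) (f u) (f v) = alt_prod (label u v) (f v) (f u).
    move=> hM Zu Zv fZ; rewrite !fZ // -!(alt_on Z) //.
    by rewrite agen_braid.
  have [Xu|Xu] := boolP (u \in X); have [Xv|Xv] := boolP (v \in X).
  - exact: (on X f1).
  - have [Yu|Yu] := boolP (u \in Y); last by have := noedge u v Yu Xv; rewrite uv.
    by apply: (on Y f2) => //; have := covers v; rewrite (negPf Xv).
  - have [Yv|Yv] := boolP (v \in Y).
      by apply: (on Y f2) => //; have := covers u; rewrite (negPf Xu).
    by have := noedge v u Yv Xu; rewrite edge_sym uv.
  - have Yu : u \in Y by have := covers u; rewrite (negPf Xu).
    have Yv : v \in Y by have := covers v; rewrite (negPf Xv).
    exact: (on Y f2).
have [phi phiM phif] := artin_lift fB.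
(* Serves for both restrictions of [phi] and, with [Z] the whole vertex set, for its uniqueness. *)
have agree Z (h psi : artin_group G -> hT) : {morph psi : x y / x * y} ->
    morph_on (special Z) h ->
    (forall s, s \in Z -> psi (agen s) = h (agen s)) ->
    forall x, special Z x -> psi x = h x.
  move=> psiM hM hZ x Zx.
  have psiMZ : morph_on (special Z) psi by move=> ? ? _ _; apply: psiM.
  have ZE := special_min (subgroup_equalizer (special_subgroup Z) psiMZ hM).
  have [s Zs|//] := ZE Z _ x Zx.
  by split; [apply: special_agen | apply: hZ].
exists phi; last first.
  move=> psi [psiM psi1 psi2] x.
  apply: (agree _ _ _ psiM _ _ _ (specialT x)) => [? ? _ _|s _]; first exact: phiM.
  rewrite phif /f; case: ifP => Xs; [apply: psi1|apply: psi2]; apply: special_agen => //.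
  by have := covers s; rewrite Xs.
split=> //.
  by apply: agree => // s Xs; rewrite phif fX.
by apply: agree => // s Ys; rewrite phif fY.
Qed.

End ArtinBasics.

(** * Products of two deformed reflections *)

Section TwoReflections.
Import GRing.Theory.
Local Open Scope ring_scope.
Variables (K : fieldType) (I : Type).
Implicit Types (v w : I -> K).

Definition combine v (a : K) w : I -> K := fun x => v x + a * w x.

Variables (alpha beta : I -> K) (lam mu : (I -> K) -> K) (q c : K).
Hypothesis lamP : forall v a w, lam (combine v a w) = lam v + a * lam w.
Hypothesis muP : forall v a w, mu (combine v a w) = mu v + a * mu w.
Hypotheses (lam_alpha : lam alpha = - (q + 1)) (mu_beta : mu beta = - (q + 1)).
Hypotheses (lam_beta : lam beta = c) (mu_alpha : mu alpha = c).

Let sigma v := combine v (lam v) alpha.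
Let tau v := combine v (mu v) beta.
Let rot v := sigma (tau v).

(** If the pair is [(x, y)], the [k]-th power of [rot] sends [alpha] to [x alpha + c y beta].
    Factoring [c] out covers the case [c = 0], and the same pair governs the form [mu] in
    [mu_iter_rot]. *)
Fixpoint rot_coef k : K * K :=
  if k is k'.+1 then
    let p := rot_coef k' in
    ((c ^+ 2 - q) * p.1 - q * c ^+ 2 * p.2, p.1 - q * p.2)
  else (1, 0).

Lemma rotE v : rot v = combine (combine v (mu v) beta) (lam v + mu v * c) alpha.
Proof. by rewrite /rot /sigma /tau lamP lam_beta. Qed.

Lemma rot_combine v a w : rot (combine v a w) = combine (rot v) a (rot w).
Proof. by apply: funext => x; rewrite !rotE /combine -/(combine v a w) lamP muP; ring. Qed.

Lemma iter_rot_combine k v a w :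
  iter k rot (combine v a w) = combine (iter k rot v) a (iter k rot w).
Proof. by elim: k => //= k ->; apply: rot_combine. Qed.

Lemma iter_rot_alpha k :
  iter k rot alpha =
  combine (combine (fun=> 0) (rot_coef k).1 alpha) ((rot_coef k).2 * c) beta.
Proof.
elim: k => [|k IH] /=; first by apply: funext => x; rewrite /combine; ring.
have rot0 : rot (fun=> 0) = fun=> 0.
  have lin f : (forall v a w, f (combine v a w) = f v + a * f w) -> f (fun=> 0) = 0 :> K.
    move=> fP; have := fP (fun=> 0) (-1) (fun=> 0).
    rewrite (_ : combine _ _ _ = fun=> 0) => [->|]; first by ring.
    by apply: funext => x; rewrite /combine; ring.
  by apply: funext => x; rewrite rotE /combine (lin lam) // (lin mu) //; ring.
rewrite IH !rot_combine rot0; apply: funext => x.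
by rewrite !rotE /combine mu_alpha lam_alpha lam_beta mu_beta; ring.
Qed.

Lemma mu_iter_rot k v :
  mu (iter k rot v) = (rot_coef k).1 * mu v + (rot_coef k).2 * (c * lam v).
Proof.
elim: k v => [|k IH] v; first by rewrite /=; ring.
by rewrite iterSr IH rotE !(muP, lamP) mu_beta mu_alpha lam_beta lam_alpha /=; ring.
Qed.

(** Once the [alpha] coordinate vanishes, [rot^k] sends [alpha] to a multiple of [beta], and [mu]
    composed with [rot^k] is the same multiple of [lam]. The conclusion is the braid relation of
    length [2k + 1]. *)
Lemma rot_braid k : (rot_coef k).1 = 0 ->
  iter k rot \o sigma =1 tau \o iter k rot.
Proof.
move=> x0 v /=; rewrite {1}/sigma iter_rot_combine iter_rot_alpha x0.
rewrite -[RHS]/(combine (iter k rot v) (mu (iter k rot v)) beta).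
by apply: funext => x; rewrite mu_iter_rot x0 /combine; ring.
Qed.

Section RootOfUnity.
Variables (p z : K).
Hypotheses (q0 : q != 0) (qE : q = p ^+ 2) (cE : c = p * (z + z^-1)) (z0 : z != 0).

Lemma rot_coefE k :
  ((z ^+ 2 - z ^- 2) * (rot_coef k).1 =
     q ^+ k * (z ^+ (k.+1 * 2) - z ^- (k.+1 * 2) + z ^+ (k * 2) - z ^- (k * 2))) /\
  ((z ^+ 2 - z ^- 2) * (q * (rot_coef k).2) = q ^+ k * (z ^+ (k * 2) - z ^- (k * 2))).
Proof.
have cq : c ^+ 2 = q * (z ^+ 2 + z ^- 2 + 2) by rewrite cE qE; field.
elim: k => [|k [IHx IHy]].
  by rewrite mul1n mul0n !expr0 invr1 /=; split; ring.
rewrite [rot_coef _]/= [fst _]/= [snd _]/=; set x := (rot_coef k).1 in IHx *.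
set y := (rot_coef k).2 in IHy *; set D := z ^+ 2 - z ^- 2 in IHx IHy *.
have e (j : nat) : z ^+ (j.+1 * 2) = z ^+ (j * 2) * z ^+ 2 by rewrite mulSn addnC exprD.
have zk0 : z ^+ (k * 2) != 0 by rewrite expf_neq0.
rewrite !e in IHx *; set zk := z ^+ (k * 2) in IHx IHy zk0 *.
split.
  rewrite (_ : D * _ = (c ^+ 2 - q) * (D * x) - c ^+ 2 * (D * (q * y))); last by ring.
  by rewrite IHx IHy cq (exprS q k); field; rewrite z0 zk0.
rewrite -[_.2]/(x - q * y) (_ : D * _ = q * (D * x) - q * (D * (q * y))); last by ring.
by rewrite IHx IHy (exprS q k); field; rewrite z0 zk0.
Qed.

Hypothesis z4 : z ^+ 4 != 1.

Let D0 : z ^+ 2 - z ^- 2 != 0.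
Proof.
apply: contraNneq z4 => D0; apply/eqP.
have z20 : z ^+ 2 != 0 by rewrite expf_neq0.
have /(congr1 (fun t => t * z ^+ 2)) := D0.
by rewrite mul0r mulrBl mulVf // -exprD => /eqP; rewrite subr_eq0 => /eqP.
Qed.

(** Here [z^(2k+2) = z] and [z^(2k) = z^-1], so the four terms of the closed form cancel. *)
Lemma rot_coef_braid k : z ^+ (k.*2.+1) = 1 -> (rot_coef k).1 = 0.
Proof.
move=> zk; have [e _] := rot_coefE k; apply: (mulfI D0); rewrite mulr0 e.
have -> : z ^+ (k.+1 * 2) = z by rewrite muln2 doubleS exprS zk mulr1.
have -> : z ^+ (k * 2) = z^-1.
  by apply: (mulfI z0); rewrite mulfV // muln2 -exprS.
by rewrite invrK; ring.
Qed.

Lemma rot_coef_full m : z ^+ m = 1 -> rot_coef m = (q ^+ m, 0).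
Proof.
move=> zm; have [e1 e2] := rot_coefE m.
have zm2 : z ^+ (m * 2) = 1 by rewrite exprM zm expr1n.
have zm3 : z ^+ (m.+1 * 2) = z ^+ 2 by rewrite mulSn exprD zm2 mulr1.
rewrite [LHS]surjective_pairing; congr pair.
  by apply: (mulfI D0); rewrite e1 zm2 zm3 invr1; ring.
apply: (mulfI q0); apply: (mulfI D0); rewrite e2 zm2 invr1; ring.
Qed.

End RootOfUnity.

Lemma rot_coef_parabolic k : q = 1 -> c = 2 -> rot_coef k = (k%:R * 2 + 1, k%:R).
Proof.
move=> q1 c2; elim: k => [|k IH] /=; first by rewrite mul0r add0r.
by rewrite IH /= q1 c2 -(natr1 k); congr pair; ring.
Qed.

Lemma rot_coef_orthogonal k : c = 0 -> (rot_coef k).1 = (- q) ^+ k.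
Proof. by move=> c0; elim: k => //= k ->; rewrite c0 (exprS (- q) k); ring. Qed.

End TwoReflections.

(** * The Burau-type representation of an Artin group *)

Section Representation.
Import Order.TTheory GRing.Theory Num.Theory.
Local Open Scope ring_scope.
Variables (G : labelled_graph) (p : algC).
Hypothesis p_neq0 : p != 0.

Let q := p ^+ 2.
Let q_neq0 : q != 0. Proof. by rewrite expf_neq0. Qed.

(** A primitive root of unity of order [m]; the value at [m = 0] is a dummy. *)
Definition odd_root (m : nat) : algC :=
  if m is m'.+1 then sval (C_prim_root_exists (ltn0Sn m')) else 1.

(** An odd [m >= 2] does not divide 4; the last condition keeps the two eigenvalues of the rotation
    distinct. *)
Lemma odd_rootP m : odd m -> (2 <= m)%N ->
  [/\ odd_root m != 0, odd_root m ^+ m = 1 & odd_root m ^+ 4 != 1].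
Proof.
case: m => // m om m2; rewrite /odd_root; case: C_prim_root_exists => z /= zP.
have zm := prim_expr_order zP; split=> //.
  by apply: contra_eqN zm => /eqP ->; rewrite expr0n /= eq_sym oner_eq0.
rewrite -(prim_order_dvd zP); apply: contraL om => m4.
have : (m.+1 <= 4)%N by apply: dvdn_leq.
by case: m zm zP m2 m4 => [|[|[|[|]]]].
Qed.

(* Up to the deformation by q = p^2, this replaces 2 cos(pi/m): an odd edge needs
   an honest root of unity, whereas for an even edge it is enough to let the two
   reflections commute. The value 2 on non-edges makes the product of the two
   reflections unipotent of infinite order at p = 1. *)
Definition coupling (s t : G) : algC :=
  if edge s t then
    if odd (label s t) then p * (odd_root (label s t) + (odd_root (label s t))^-1)
    else 0
  else 2.

(** The diagonal value makes [refl s] multiply [root_vec s] by [-q]; at [q = 1] this is an ordinary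
    reflection. *)
Definition cartan (s t : G) : algC := if s == t then - (q + 1) else coupling s t.

Lemma coupling_sym s t : coupling s t = coupling t s.
Proof.
by rewrite /coupling edge_sym; case: ifP => // /label_sym ->.
Qed.

Definition root_vec (s : G) : G -> algC := fun x => (x == s)%:R.
Definition root_form (s : G) (v : G -> algC) : algC := \sum_t cartan s t * v t.

Lemma root_form_combine s v a w :
  root_form s (combine v a w) = root_form s v + a * root_form s w.
Proof.
rewrite /root_form mulr_sumr -big_split; apply: eq_bigr => t _ /=.
by rewrite /combine; ring.
Qed.

Lemma root_form_vec s t : root_form s (root_vec t) = cartan s t.
Proof.
rewrite /root_form (bigD1 t) //= /root_vec eqxx mulr1 big1 ?addr0 // => u ut.
by rewrite (negPf ut) mulr0.
Qed.

Definition refl s v := combine v (root_form s v) (root_vec s).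
Definition refl_inv s v := combine v (q^-1 * root_form s v) (root_vec s).

Let form_refl s v a : root_form s (combine v a (root_vec s)) = root_form s v - a * (q + 1).
Proof. by rewrite root_form_combine root_form_vec /cartan eqxx mulrN. Qed.

Lemma reflK s : cancel (refl s) (refl_inv s).
Proof.
move=> v; rewrite /refl_inv form_refl; apply: funext => x.
by rewrite /refl /combine; field.
Qed.

Lemma refl_invK s : cancel (refl_inv s) (refl s).
Proof.
move=> v; rewrite /refl form_refl; apply: funext => x.
by rewrite /refl_inv /combine; field.
Qed.

Definition refl_bij s : bijection (G -> algC) := Bijection (reflK s) (refl_invK s).

Local Notation rot s t := (fun v => refl s (refl t v)).

Lemma refl_bij_pow s t k v :
  ((refl_bij s * refl_bij t) ^+ k)%g v = iter k (rot s t) v.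
Proof. by elim: k v => [|k IH] v; rewrite ?expg0 // expgS bijM IH. Qed.

(** For an even label it suffices that the two reflections commute, which holds since the coupling
    vanishes; an odd label [2k + 1] is handled by [rot_braid] at [k]. *)
Lemma refl_braid s t : edge s t ->
  alt_prod (label s t) (refl_bij s) (refl_bij t) =
  alt_prod (label s t) (refl_bij t) (refl_bij s).
Proof.
move=> st; have nst : s != t by apply: contraTneq st => ->; rewrite edge_irr.
have nts : t != s by rewrite eq_sym.
have [om|em] := boolP (odd (label s t)); last first.
  apply: alt_prod_comm => //; apply: eq_bijection => v; rewrite !bijM /=.
  have c0 : coupling s t = 0 by rewrite /coupling st (negPf em).
  rewrite /refl !root_form_combine !root_form_vec /cartan (negPf nst) (negPf nts).
  by rewrite (coupling_sym t) c0; apply: funext => x; rewrite /combine; ring.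
have [z0 zm z4] := odd_rootP om (label_ge2 st).
have cE : coupling s t =
    p * (odd_root (label s t) + (odd_root (label s t))^-1).
  by rewrite /coupling st om.
have mE : label s t = (label s t)./2.*2.+1 by rewrite -[LHS]odd_double_half om.
set k := _./2 in mE; set z := odd_root _ in z0 zm z4 cE.
have kP : (rot_coef q (coupling s t) k).1 = 0.
  by apply: (rot_coef_braid (erefl q) cE z0 z4); rewrite -mE.
apply: eq_bijection => v; rewrite [X in alt_prod X]mE.
(* The two sides become [(st)^k s] and [t (st)^k]. *)
rewrite -addn1 alt_prodD odd_double alt_prod1 alt_prod_double bijM refl_bij_pow.
rewrite addn1 alt_prodS alt_prod_double bijM refl_bij_pow.
have form_ss u : root_form u (root_vec u) = - (q + 1) by rewrite root_form_vec /cartan eqxx.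
have form_st : root_form s (root_vec t) = coupling s t.
  by rewrite root_form_vec /cartan (negPf nst).
have form_ts : root_form t (root_vec s) = coupling s t.
  by rewrite root_form_vec /cartan (negPf nts) coupling_sym.
exact: (rot_braid (root_form_combine s) (root_form_combine t)
  (form_ss s) (form_ss t) form_st form_ts kP v).
Qed.

Lemma iter_rot_root s t k : s != t ->
  iter k (rot s t) (root_vec s) =
  combine (combine (fun=> 0) (rot_coef q (coupling s t) k).1 (root_vec s))
    ((rot_coef q (coupling s t) k).2 * coupling s t) (root_vec t).
Proof.
move=> nst; apply: iter_rot_alpha; rewrite ?root_form_vec /cartan ?eqxx //.
- exact: root_form_combine.
- exact: root_form_combine.
- by rewrite (negPf nst).
- by rewrite eq_sym (negPf nst) coupling_sym.
Qed.

(** For an odd label the power of the rotation multiplies the root by [q^m]; for an even one the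
    coordinate is [(-q)^m], which is the same. *)
Lemma iter_rot_root_edge s t : edge s t ->
  iter (label s t) (rot s t) (root_vec s) s = q ^+ label s t.
Proof.
move=> st; have nst : s != t by apply: contraTneq st => ->; rewrite edge_irr.
rewrite iter_rot_root // /combine /root_vec eqxx (negPf nst) mulr0 mulr1 addr0 add0r.
have [om|em] := boolP (odd (label s t)); last first.
  by rewrite rot_coef_orthogonal /coupling ?st ?(negPf em) // exprNn -signr_odd (negPf em) mul1r.
have [z0 zm z4] := odd_rootP om (label_ge2 st).
have cE : coupling s t = p * (odd_root (label s t) + (odd_root (label s t))^-1).
  by rewrite /coupling st om.
by rewrite (rot_coef_full q_neq0 (erefl q) cE z0 z4 zm).
Qed.

End Representation.

(** * Separating elements from special subgroups *)

Section ArtinSeparation.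
Import Order.TTheory GRing.Theory Num.Theory.
Local Open Scope ring_scope.
Variable G : labelled_graph.
Implicit Types (Z : {set G}) (g : artin_group G).

Let two_neq0 : (2 : algC) != 0. Proof. by rewrite pnatr_eq0. Qed.
(** The representation is taken at [p = 2], so that [q = 4] is not a root of unity. *)
Let q : algC := 2 ^+ 2.
Let rho_ex := artin_lift (@refl_braid G 2 two_neq0).
Let rho : artin_group G -> bijection (G -> algC) := s2val (cid2 rho_ex).
Let rhoM : {morph rho : x y / (x * y)%g} := s2valP (cid2 rho_ex).
Let rho_agen s v : rho (agen s) v = refl 2 s v.
Proof. by rewrite /rho (s2valP' (cid2 rho_ex)). Qed.

Let q_pow n : (0 < n)%N -> q ^+ n != 1.
Proof.
move=> n0; rewrite /q -exprM -natrX pnatr_eq1 -(expn0 2) eqn_exp2l //.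
by rewrite muln_eq0 /= -lt0n.
Qed.

(** Only the reflection in [x] moves the coordinate [x]. Hence a changed coordinate outside [Z]
    shows that an element is not in [A_Z]. *)
Lemma rho_special Z g v x : special Z g -> x \notin Z -> rho g v x = v x.
Proof.
move=> Zg Zx; move: g Zg v.
apply: (special_min (H := [set g | forall v, rho g v x = v x]%classic)) => [|s Zs].
  split=> [v|g h /= gx hx v|g /= gx v]; first by rewrite (morph1 rhoM).
    by rewrite rhoM bijM gx hx.
  by rewrite -[in RHS](bij1 v) -(mulgV (rho g)) bijM gx -(morphV rhoM).
move=> v /=; rewrite rho_agen /refl /combine /root_vec.
have /negPf -> : x != s by apply: contraNneq Zx => ->.
by rewrite mulr0 addr0.
Qed.

Lemma special_agenE Z u : special Z (agen u) -> u \in Z.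
Proof.
move=> Zu; apply: contraT => nZu.
have := rho_special (root_vec u) Zu nZu.
rewrite rho_agen /refl /combine root_form_vec /cartan /root_vec eqxx mulr1 => /eqP.
rewrite -subr_eq0 (_ : _ - _ = - (2 ^+ 2 + 1)); last by ring.
by rewrite oppr_eq0 -natrX -(natrD _ _ 1) pnatr_eq0.
Qed.

Lemma special_rot_pow Z u w : edge u w ->
  special Z ((agen u * agen w) ^+ label u w)%g -> u \in Z.
Proof.
move=> uw Zuw; apply: contraT => nZu.
have := rho_special (root_vec u) Zuw nZu.
rewrite (morphX _ rhoM) rhoM.
have -> k v : ((rho (agen u) * rho (agen w)) ^+ k)%g v =
    iter k (fun v => refl 2 u (refl 2 w v)) v.
  by elim: k v => [|k IH] v; rewrite ?expg0 // expgS !bijM IH !rho_agen.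
rewrite iter_rot_root_edge // /root_vec eqxx => /eqP e.
have : (0 < label u w)%N by apply: leq_trans (label_ge2 uw).
by move=> /q_pow; rewrite /q e.
Qed.

(** The generator [w] multiplies its own root by [-q], which is not a root of unity. *)
Lemma agen_pow_inj (w : G) : injective (fun n => agen w ^+ n)%g.
Proof.
suff main m n : (agen w ^+ m)%g = (agen w ^+ (m + n))%g -> n = 0%N.
  move=> m n /= e; case: (leqP m n) => [|/ltnW] /subnKC mn.
    by move: e; rewrite -mn => /main ->; rewrite addn0.
  by move: e; rewrite -mn => /esym/main ->; rewrite addn0.
rewrite expgnDr -[LHS]mulg1 => /mulgI /esym e1; apply: contraTeq isT; rewrite -lt0n => n0.
have := congr1 (fun g => rho g (root_vec w) w) e1.
rewrite (morphX _ rhoM) (morph1 rhoM) bij1.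
have -> : (rho (agen w) ^+ n)%g (root_vec w) = combine (fun=> 0) ((- q) ^+ n) (root_vec w).
  elim: (n) => [|k IH]; first by apply: funext => x; rewrite expg0 bij1 /combine; ring.
  rewrite expgS bijM IH rho_agen /refl root_form_combine root_form_vec /cartan eqxx.
  have -> : root_form 2 w (fun=> 0) = 0 by rewrite /root_form big1 // => t; rewrite mulr0.
  by apply: funext => x; rewrite /combine (exprS _ k) /q; ring.
rewrite /combine /root_vec eqxx mulr1 add0r => e2.
have /eqP[] : q ^+ (n * 2) != 1 by apply: q_pow; rewrite muln_gt0 n0.
by rewrite mulnC exprM -sqrrN -exprM mulnC exprM e2 expr1n.
Qed.

(** Squares are used because an isometry of a line may be a reversal, whereas its square is a
    translation. *)
Lemma agen_sq_noncomm (a b : G) : a != b -> ~~ edge a b ->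
  (agen a ^+ 2 * agen b ^+ 2)%g <> (agen b ^+ 2 * agen a ^+ 2)%g.
Proof.
move=> ab nab e.
have cab : root_form 2 a (root_vec b) = 2.
  by rewrite root_form_vec /cartan (negPf ab) /coupling (negPf nab).
have := congr1 (fun g => rho g (root_vec b) a) e.
have form_ss (u : G) : root_form 2 u (root_vec u) = - (q + 1) by rewrite root_form_vec /cartan eqxx.
rewrite !rhoM !bijM !rho_agen /refl !(root_form_combine, form_ss, cab) /combine /root_vec.
rewrite eqxx (negPf ab) => /eqP; rewrite -subr_eq0.
(* The coordinates are [-96] on the left and [-6] on the right, whence the constant 90. *)
set E := (X in X == 0); rewrite (_ : E = - 90%:R); first by rewrite oppr_eq0 pnatr_eq0.
by rewrite /E !(mulr0n, mulr1n) /q; ring.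
Qed.

End ArtinSeparation.

(** * Spherical graphs are complete *)

Section SphericalGraphs.
Import Order.TTheory GRing.Theory Num.Theory.
Local Open Scope ring_scope.
Variable G : labelled_graph.

(** At [p = 1] the reflections are involutions and represent the Coxeter group. A missing edge has
    coupling 2, and the powers of [st] are then told apart by the coordinate [2k + 1]. *)
Lemma spherical_graph_edge (s t : G) : spherical_graph G -> s != t -> edge s t.
Proof.
move=> fin st; apply: contraPT fin => nst.
have one_neq0 : (1 : algC) != 0 by rewrite oner_eq0.
have [|rho rhoM rhos] := @pres_group_lift _ (@coxeter_rel G) _ (@refl_bij G 1 one_neq0).
  move=> _ _ [_ _ [u v uv]|u].
    by rewrite !prod_alt_word refl_braid.
  rewrite !big_cons !big_nil mulg1; apply: eq_bijection => v; rewrite bijM /= /refl.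
  rewrite root_form_combine root_form_vec /cartan eqxx.
  by apply: funext => x; rewrite /combine; ring.
pose g := (pres_gen (@coxeter_rel G) s * pres_gen (@coxeter_rel G) t)%g.
have gE k : rho (g ^+ k)%g (root_vec s) s = k%:R * 2 + 1.
  rewrite (morphX _ rhoM) rhoM !rhos refl_bij_pow iter_rot_root //.
  rewrite rot_coef_parabolic ?expr1n ?/coupling ?(negPf nst) //.
  by rewrite /combine /root_vec eqxx (negPf st) /= mulr1 mulr0 add0r addr0.
move=> /finite_setPn; apply.
have gI : {in (classical_sets.setT : set nat) &, injective (fun k => g ^+ k)%g}.
  move=> m n _ _ /(congr1 (fun g => rho g (root_vec s) s)).
  rewrite !gE => /addIr /mulIf; rewrite pnatr_eq0 => /(_ isT) /eqP.
  by rewrite eqr_nat => /eqP.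
apply: card_le_trans (subset_card_le (@subsetT _ (range (fun k => g ^+ k)%g))).
by have /card_eqPle[] := inj_card_eq gI.
Qed.

End SphericalGraphs.

(** * Toggling letters in reduced words *)

Section Toggle.
Variable E : eqType.
Implicit Types (e : E) (s : seq E).

Definition reduced s := sorted (fun x y => x != y) s.

(** Left multiplication by a generator in a free product of groups of order 2, acting on reduced
    words. Other sequences are fixed, so that it is an involution of the whole type. *)
Definition toggle e s :=
  if reduced s then
    if s is x :: s' then if x == e then s' else e :: s else [:: e]
  else s.

Lemma toggleK e : involutive (toggle e).
Proof.
move=> s; rewrite /toggle; case: (boolP (reduced s)) => [|/negPf -> //].
case: s => [|x s] rs; first by rewrite /= eqxx.
case: (eqVneq x e) rs => [-> rs|xe rs]; last first.
  by rewrite /reduced /= eq_sym xe (rs : path _ x s) eqxx.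
have -> : reduced s by apply: path_sorted rs.
by case: s rs => [//|y s] /= /andP[/negPf ey _]; rewrite eq_sym ey.
Qed.

End Toggle.

(** * Cosets and their stabilisers *)

Section Cosets.
Local Open Scope classical_set_scope.
Local Open Scope group_scope.
Variable gT : groupType.
Implicit Types (H K L : set gT) (g x : gT).

Lemma lcoset_setP g H x : lcoset_set g H x <-> H (g^-1 * x).
Proof.
by split=> [[y Hy <-]|Hx]; [rewrite mulKg | exists (g^-1 * x); rewrite ?mulVKg].
Qed.

Lemma lcoset_set_id H g : is_subgroup H -> H g -> lcoset_set g H = H.
Proof.
move=> [H1 HM HV] Hg; apply/seteqP; split=> x.
  by move=> /lcoset_setP /(HM _ _ Hg); rewrite mulVKg.
by move=> Hx; apply/lcoset_setP/HM => //; apply: HV.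
Qed.

Lemma lcoset_set_eq H g h : is_subgroup H ->
  lcoset_set g H = lcoset_set h H <-> H (g^-1 * h).
Proof.
move=> sH; split=> [e|ghH].
  by apply/lcoset_setP; rewrite e; apply/lcoset_setP; rewrite mulVg; case: sH.
by rewrite -[h](mulVKg g) lcoset_setM (lcoset_set_id sH ghH).
Qed.

Definition coset_of H g : left_cosets H :=
  exist (fun C => exists g, C = lcoset_set g H) (lcoset_set g H) (ex_intro _ g erefl).

Lemma coset_ofP H (C : left_cosets H) : exists g, C = coset_of H g.
Proof. by have [g Cg] := svalP C; exists g; apply: left_cosets_inj. Qed.

Lemma lcoset_act_coset H g h : lcoset_act g (coset_of H h) = coset_of H (g * h).
Proof. by apply: left_cosets_inj; rewrite /= lcoset_setM. Qed.

Lemma coset_of_eq H g h : is_subgroup H -> coset_of H g = coset_of H h <-> H (g^-1 * h).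
Proof.
move=> sH; rewrite -(lcoset_set_eq g h sH); split=> [/(congr1 sval)//|e].
by apply: left_cosets_inj.
Qed.

Lemma coset_of_mem H g (C : left_cosets H) : is_subgroup H -> sval C g -> C = coset_of H g.
Proof.
move=> sH; have [h ->] := coset_ofP C => /lcoset_setP hg.
exact/(coset_of_eq _ _ sH).
Qed.

Lemma coset_stabiliser H (C : left_cosets H) x k :
  is_subgroup H -> C = coset_of H x -> lcoset_act k C = C -> conj_set x H k.
Proof.
move=> sH ->; rewrite lcoset_act_coset => /esym/(coset_of_eq _ _ sH) Hk.
by exists (x^-1 * (k * x)) => //; rewrite !mulgA mulgV mul1g mulgK.
Qed.

Lemma conj_setV H K x g :
  conj_set g K `<=` conj_set x H -> conj_set (x^-1 * g) K `<=` H.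
Proof.
move=> sub _ [k Kk <-]; have [|h Hh e] := sub (g * k * g^-1); first by exists k.
suff -> : x^-1 * g * k * (x^-1 * g)^-1 = h by [].
have -> : x^-1 * g * k * (x^-1 * g)^-1 = x^-1 * (g * k * g^-1) * x.
  by rewrite invgM invgK !mulgA.
by rewrite -e !mulgA mulVg mul1g -mulgA mulVg mulg1.
Qed.

End Cosets.

(** * Acyclicity of the Bass-Serre tree and alternating words *)

Section BassSerreTree.
Local Open Scope classical_set_scope.
Local Open Scope group_scope.
Variables (gT : groupType) (H K L : set gT).
Hypotheses (sH : is_subgroup H) (sK : is_subgroup K) (sL : is_subgroup L).
Hypothesis amal : is_amalgam H K L.
Hypothesis genHK : forall g, generated (H `|` K) g.

Local Notation V := (bs_vertex H K).
Local Notation adj := (@bs_adj gT H K L).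

(** Adjacency together with the coset of [L] that witnesses it, kept as a plain set: these sets are
    the letters of the words below. *)
Definition bs_joins (e : set gT) (u v : V) : Prop :=
  match u, v with
  | inl C, inr D | inr D, inl C =>
      [/\ exists g, e = lcoset_set g L, e `<=` sval C & e `<=` sval D]
  | _, _ => False
  end.

Lemma bs_adj_joins u v : adj u v -> exists e, bs_joins e u v.
Proof.
case: u v => [C|D] [C'|D'] //= [E [EC ED]]; exists (sval E); split=> //; exact: (svalP E).
Qed.

Lemma bs_joins_unique e u v w : bs_joins e u v -> bs_joins e v w -> u = w.
Proof.
have [L1 _ _] := sL.
have eg g : e = lcoset_set g L -> e g by move=> ->; apply/lcoset_setP; rewrite mulVg.
case: v => [D|D]; case: u => [C|C] //; case: w => [C'|C'] //=;
  move=> [[g /eg g_e] eC eD] [_ eD' eC']; congr (_ _).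
  by rewrite (coset_of_mem sK (eD _ g_e)) (coset_of_mem sK (eC' _ g_e)).
by rewrite (coset_of_mem sH (eC _ g_e)) (coset_of_mem sH (eD' _ g_e)).
Qed.

(* The amalgam maps to the permutations of gT * (words in the cosets of L): H
   acts by translations, and K by translations conjugated by the involution that
   toggles at (x, w) the letter x^-1 L, which commutes with translations by L.
   Reading the word component makes every vertex act on words, and crossing an
   edge amounts to toggling the corresponding letter. *)
Lemma bs_potential : exists W : V -> seq (set gT) -> seq (set gT),
  (forall v, exists w, W v w = [::]) /\
  (forall e u v w, bs_joins e u v -> W v w = toggle e (W u w)).
Proof.
have [L1 LM LV] := sL.
pose T := (gT * seq (set gT))%type.
pose tog (t : T) : T := (t.1, toggle (lcoset_set t.1^-1 L) t.2).
have togK : involutive tog by case=> x w; rewrite /tog /= toggleK.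
pose trans g (t : T) : T := (g * t.1, t.2).
have transK g : cancel (trans g) (trans g^-1) by case=> x w; rewrite /trans /= mulKg.
have transVK g : cancel (trans g^-1) (trans g) by case=> x w; rewrite /trans /= mulVKg.
pose c : bijection T := Bijection togK togK.
pose f1 g : bijection T := Bijection (transK g) (transVK g).
pose f2 g : bijection T := c * f1 g * c.
have cc : c * c = 1 by apply: eq_bijection => t; apply: togK.
have f1M : {morph f1 : x y / x * y}.
  by move=> x y; apply: eq_bijection => -[z w]; rewrite bijM /= /trans /= mulgA.
have f2M : {morph f2 : x y / x * y}.
  by move=> x y; rewrite /f2 f1M !mulgA -(mulgA _ c c) cc mulg1.
(* For [x] in [L] the letter is unchanged, since [(x z)^-1 L = z^-1 L], so the two toggles
   cancel. *)
have f12 x : L x -> f1 x = f2 x.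
  move=> Lx; rewrite /f2; apply: eq_bijection => -[z w]; rewrite !bijM /=.
  rewrite /trans /tog /= invgM lcoset_setM.
  by rewrite (lcoset_set_id sL (LV _ Lx)) toggleK.
have [_ _ ext] := amal.
have [phi [phiM phiH phiK] _] :=
  ext _ f1 f2 (fun x y _ _ => f1M x y) (fun x y _ _ => f2M x y) f12.
pose repr_of (A : set gT) (C : left_cosets A) := projT1 (cid (svalP C)).
pose W (v : V) w :=
  match v with
  | inl C => (phi (repr_of _ C)^-1 (1, w)).2
  | inr D => (c (phi (repr_of _ D)^-1 (1, w))).2
  end.
(* Elements of [H] act on the first component only, so the chosen representative of the coset does
   not matter. *)
have WH g w : W (inl (coset_of H g)) w = (phi g^-1 (1, w)).2.
  rewrite /W /repr_of; case: cid => h /= /(lcoset_set_eq _ _ sH) Hgh.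
  have -> : h^-1 = (g^-1 * h)^-1 * g^-1 by rewrite invgM invgK mulgK.
  rewrite phiM bijM phiH //; by case: sH => _ _; apply.
have WK g w : W (inr (coset_of K g)) w = (c (phi g^-1 (1, w))).2.
  rewrite /W /repr_of; case: cid => h /= /(lcoset_set_eq _ _ sK) Kgh.
  have -> : h^-1 = (g^-1 * h)^-1 * g^-1 by rewrite invgM invgK mulgK.
  rewrite phiM bijM phiK ?/f2 ?bijM; last by case: sK => _ _; apply.
  by rewrite -[LHS]/(tog (tog (f1 (g^-1 * h)^-1 (c (phi g^-1 (1, w)))))).2 togK.
(* The first component follows left translation; that of [phi g^-1 (1, w)] is thus [g^-1], and
   applying [c] there toggles the letter [g L]. *)
have phi1 g : forall t, (phi g t).1 = g * t.1.
  have sP : is_subgroup [set g | forall t, (phi g t).1 = g * t.1].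
    split=> [t|x y /= xP yP t|x /= xP t]; first by rewrite (morph1 phiM) mul1g.
      by rewrite phiM bijM xP yP mulgA.
    by apply: (mulgI x); rewrite -xP -bijM -phiM mulgV (morph1 phiM) mulVKg.
  apply: (generated_min sP) (genHK g) => x [Hx|Kx] t /=; first by rewrite phiH.
  by rewrite phiK.
exists W; split.
  suff surj g (t : T) : t.1 = g^-1 -> exists w, phi g^-1 (1, w) = t.
    case=> C; have [g ->] := coset_ofP C.
      have [w wE] := surj g (g^-1, [::]) erefl.
      by exists w; rewrite WH wE.
    have [w wE] := surj g (c (g^-1, [::])) erefl.
    by exists w; rewrite WK wE -[c _]/(tog (tog _)) togK.
  move=> tg; exists (phi g t).2.
  have -> : (1, (phi g t).2) = phi g t by rewrite [RHS]surjective_pairing phi1 tg mulgV.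
  by rewrite -bijM -phiM mulVg (morph1 phiM).
have main g w : (c (phi g^-1 (1, w))).2 = toggle (lcoset_set g L) (phi g^-1 (1, w)).2.
  by rewrite /= phi1 mulg1 invgK.
have coset_L e g (Z : set gT) (C : left_cosets Z) : is_subgroup Z ->
    e = lcoset_set g L -> e `<=` sval C -> C = coset_of Z g.
  move=> sZ eE eC; apply: coset_of_mem => //; apply: eC; rewrite eE.
  by apply/lcoset_setP; rewrite mulVg.
move=> e [C|D] [C'|D'] w // [[g eE] eC eD].
  by rewrite (coset_L e g H C sH eE eC) (coset_L e g K D' sK eE eD) WH WK main eE.
rewrite (coset_L e g H C' sH eE eC) (coset_L e g K D sK eE eD) WH WK main eE.
by rewrite toggleK.
Qed.

(** Without backtracking, consecutive edges differ, so each toggle adds a letter: the word read at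
    the end is reduced and as long as the path. *)
Lemma bs_path_toggle n (p : nat -> V) :
  (forall i, i < n -> adj (p i) (p i.+1)) ->
  (forall i, i.+1 < n -> p i <> p i.+2) ->
  exists (W : V -> seq (set gT) -> seq (set gT)) w,
  [/\ forall e u v w, bs_joins e u v -> W v w = toggle e (W u w),
    W (p 0) w = [::] & size (W (p n) w) = n].
Proof.
have [W [W0 WP]] := bs_potential => padj ploc; have [w w0] := W0 (p 0).
exists W, w; split=> //.
(* Strengthened for the induction: the top letter is the last edge crossed. For [n = 0] the word is
   empty and [n.-1] is never read. *)
suff : reduced (W (p n) w) /\ size (W (p n) w) = n /\
    (if W (p n) w is e :: _ then bs_joins e (p n.-1) (p n) else True) by case=> _ [].
elim: n padj ploc => [|n IH] padj ploc; first by rewrite w0.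
have [i i_n|i i_n|rn [sn jn]] := IH; [exact: padj (ltnW i_n) | exact: ploc (ltnW i_n) |].
have [e je] := bs_adj_joins (padj n (ltnSn n)).
rewrite (WP e _ _ _ je) /toggle rn.
case Wn : (W (p n) w) rn sn jn => [|x s] rn sn jn.
  by rewrite -sn in je *.
have xe : x != e.
  apply/eqP => xe; move: jn je; rewrite xe -sn /= => jn je.
  by apply: (ploc (size s)) (bs_joins_unique jn je); rewrite -sn.
rewrite (negPf xe); split; last by split=> /=; [rewrite -sn | ].
by rewrite /reduced /= eq_sym xe.
Qed.

Lemma bs_path_neq n (p : nat -> V) : 0 < n ->
  (forall i, i < n -> adj (p i) (p i.+1)) ->
  (forall i, i.+1 < n -> p i <> p i.+2) -> p 0 <> p n.
Proof.
move=> n0 padj ploc pn; have [W [w [_ w0 wn]]] := bs_path_toggle padj ploc.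
by move: n0; rewrite -wn -pn w0.
Qed.

(** Crossing the chord directly shows that the word at the far end has a single letter. *)
Lemma bs_path_adj n (p : nat -> V) :
  (forall i, i < n -> adj (p i) (p i.+1)) ->
  (forall i, i.+1 < n -> p i <> p i.+2) -> adj (p 0) (p n) -> n = 1%N.
Proof.
move=> padj ploc pn; have [W [w [WP w0 wn]]] := bs_path_toggle padj ploc.
by have [e /WP we] := bs_adj_joins pn; rewrite -wn we w0.
Qed.

Lemma bs_path_edge_path n (p : nat -> V) :
  (forall i, i < n -> adj (p i) (p i.+1)) ->
  (forall i, i.+1 < n -> p i <> p i.+2) ->
  edge_path (T := bass_serre_tree H K L) n p.
Proof.
move=> padj ploc; split=> // i j.
have neq i' j' : i' < j' -> j' <= n -> p i' <> p j'.
  move=> ij jn; have := @bs_path_neq (j' - i') (fun k => p (i' + k)).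
  rewrite addn0 subnKC ?(ltnW ij) // subn_gt0; apply=> // k kij.
    by rewrite addnS; apply: padj; apply: leq_trans jn; rewrite -ltn_subRL.
  by rewrite !addnS; apply: ploc; apply: leq_trans jn; rewrite -addnS -ltn_subRL.
move=> i_n j_n pij; case: (ltngtP i j) => // ij; first by have := neq _ _ ij j_n.
by have := neq _ _ ij i_n; rewrite pij.
Qed.

Definition alt_side (i : nat) : set gT := if odd i then K else H.
Definition alt_vertex (i : nat) (g : gT) : V :=
  if odd i then inr (coset_of K g) else inl (coset_of H g).
(** The walk [H], [l_0 K], [l_0 l_1 H], and so on. When [l_i] lies in [alt_side i], the edge from
    vertex [i] to the next one is the coset [l_0 ... l_i L]. *)
Definition alt_path (l : nat -> gT) (i : nat) : V := alt_vertex i (\prod_(j < i) l j).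

Section AlternatingWords.
Variables (n : nat) (l : nat -> gT).
Hypothesis lP : forall i, i < n -> alt_side i (l i) /\ ~ alt_side i.+1 (l i).

Let L_sub : L `<=` H /\ L `<=` K. Proof. by have [LH LK _] := amal. Qed.

Lemma alt_path_adj i : i < n -> adj (alt_path l i) (alt_path l i.+1).
Proof.
move=> /lP[]; rewrite /alt_path /alt_vertex /alt_side big_ord_recr /=.
set g := \prod_(j < i) l j; have [LH LK] := L_sub.
have gl A : is_subgroup A -> A (l i) -> lcoset_set g A = lcoset_set (g * l i) A.
  by move=> sA Al; apply/lcoset_set_eq => //; rewrite mulKg.
by case: (odd i) => /= li _; exists (coset_of L (g * l i));
  split=> /=; rewrite ?(gl _ _ li) //; apply: lcoset_setS.
Qed.

Lemma alt_path_local i : i.+1 < n -> alt_path l i <> alt_path l i.+2.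
Proof.
move=> i_n; have [li _] := lP (ltnW i_n); have [_] := lP i_n; move: li.
rewrite /alt_path /alt_vertex /alt_side 2!big_ord_recr /= negbK -mulgA.
set g := \prod_(j < i) l j.
have cancel A : is_subgroup A -> A (l i) -> lcoset_set g A = lcoset_set (g * (l i * l i.+1)) A ->
    A (l i.+1).
  move=> sA Al /(lcoset_set_eq _ _ sA); rewrite mulKg; have [_ AM AV] := sA.
  by move/(AM _ _ (AV _ Al)); rewrite mulKg.
by case: (odd i) => li nl [e]; apply: nl; apply: (cancel _ _ li e).
Qed.

Lemma alt_path_edge_path : edge_path (T := bass_serre_tree H K L) n (alt_path l).
Proof. by apply: bs_path_edge_path; [apply: alt_path_adj | apply: alt_path_local]. Qed.

(** A trivial product would close the walk; evenness puts both ends on the same side. *)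
Lemma alternating_prod_neq1 : 0 < n -> ~~ odd n -> \prod_(j < n) l j <> 1.
Proof.
move=> n0 en e.
have := bs_path_neq n0 alt_path_adj alt_path_local.
by rewrite /alt_path e big_ord0 /alt_vertex (negPf en).
Qed.

End AlternatingWords.

(** Otherwise [(uv)^m (u^-1 v^-1)^m] would be a trivial alternating word of length [4m]. *)
Lemma amalgam_no_braid m u v : 0 < m -> H u -> ~ K u -> K v -> ~ H v ->
  (u * v) ^+ m <> (v * u) ^+ m.
Proof.
move=> m0 Hu nKu Kv nHv e.
pose l i := let x := if odd i then v else u in if i < m.*2 then x else x^-1.
have [_ _ HV] := sH; have [_ _ KV] := sK.
apply: (@alternating_prod_neq1 (m.*2 + m.*2) l).
- move=> i _; rewrite /alt_side /l /=; case: (odd i) => /=; case: ifP => _; split=> //.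
  + exact: KV.
  + by move/HV; rewrite invgK.
  + exact: HV.
  + by move/KV; rewrite invgK.
- by rewrite addn_gt0 double_gt0 m0.
- by rewrite addnn odd_double.
have lo k : k <= m -> \prod_(j < k.*2) l j = (u * v) ^+ k.
  elim: k => [|k IH] km; first by rewrite big_ord0.
  rewrite doubleS 2!big_ord_recr IH /= 1?ltnW // /l /= odd_double /=.
  by rewrite ltn_double ltn_Sdouble km expgSr mulgA.
have hi k : \prod_(j < m.*2 + k.*2) l j = (u * v) ^+ m * (u^-1 * v^-1) ^+ k.
  elim: k => [|k IH]; first by rewrite addn0 lo // expg0 mulg1.
  rewrite doubleS 2!addnS 2!big_ord_recr IH /= /l /= oddD !odd_double /=.
  have c1 : (m.*2 + k.*2 < m.*2) = false by rewrite ltnNge leq_addr.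
  have c2 : ((m.*2 + k.*2).+1 < m.*2) = false by rewrite ltnNge -addnS leq_addr.
  by rewrite c1 c2 expgSr !mulgA.
by rewrite hi e -invgM expVgn mulgV.
Qed.

End BassSerreTree.

(** * Adjacency-preserving injections of the integer line *)

Section IntegerLine.
Import GRing.Theory.
Local Open Scope ring_scope.

(** Injectivity forbids turning back, so every step repeats the same increment. *)
Lemma int_path_affine (s : int -> int) : injective s ->
  (forall i, s (i + 1) = s i + 1 \/ s (i + 1) = s i - 1) ->
  exists2 e : int, e = 1 \/ e = -1 & forall i, s i = s 0 + e * i.
Proof.
move=> sI s1; pose d i := s (i + 1) - s i.
have dS i : d (i + 1) = d i.
  have := s1 i; have := s1 (i + 1); rewrite /d.
  have : s (i + 1 + 1) <> s i by move=> e; have := sI _ _ e; lia.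
  by move=> ? [] ? [] ?; lia.
have d0 i : d i = d 0.
  elim/int_rect: i => // n IH; first by rewrite -addn1 PoszD dS.
  have := dS (- n.+1%:Z); have -> : - n.+1%:Z + 1 = - n%:Z by lia.
  by rewrite IH.
exists (d 0); first by have := s1 0; rewrite /d; lia.
move=> i; elim/int_rect: i => [|n IH|n IH]; first by rewrite mulr0 addr0.
  have e : n.+1%:Z = n%:Z + 1 by lia.
  have := d0 n; rewrite {1}/d IH e mulrDr mulr1; by move/eqP; rewrite subr_eq => /eqP ->; ring.
have e' : - n%:Z = - n.+1%:Z + 1 by lia.
have := d0 (- n.+1%:Z); rewrite {1}/d -e' IH e' mulrDr mulr1.
by move/eqP; rewrite subr_eq => /eqP h; apply: (addrI (d 0)); rewrite -h; ring.
Qed.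

Lemma int_path_square (s : int -> int) : injective s ->
  (forall i, s (i + 1) = s i + 1 \/ s (i + 1) = s i - 1) ->
  exists c, forall i, s (s i) = i + c.
Proof.
move=> sI /(int_path_affine sI)[e e1 sE]; exists (s 0 + e * s 0) => i.
rewrite (sE (s i)) (sE i) mulrDr mulrA (_ : e * e = 1) ?mul1r; first by ring.
by case: e1 => ->.
Qed.

End IntegerLine.

(** * Odd classes of generators and ribbons *)

Section OddClasses.
Local Open Scope classical_set_scope.
Local Open Scope group_scope.
Variable G : labelled_graph.
Implicit Types (X Y U W : {set G}) (g : artin_group G).

Lemma odd_edge_sym : symmetric (@odd_edge G).
Proof.
move=> u v; rewrite /odd_edge edge_sym.
by case: (boolP (edge v u)) => //= /label_sym ->.
Qed.

Lemma connect_odd_sym : connect_sym (@odd_edge G).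
Proof. exact/sym_connect_sym/odd_edge_sym. Qed.

(* Only relations of odd length identify the two generators of an edge in the
   abelianisation, so the parity of an odd class is a well defined character. *)
Lemma conj_gen_odd_connected (x y : G) g :
  g * agen x * g^-1 = agen y -> connect (@odd_edge G) x y.
Proof.
pose f (s : G) : 'Z_2 := if connect (@odd_edge G) x s then Zp1 else 1.
have [|chi chiM chif] := @artin_lift G 'Z_2 f.
  move=> u v uv; have [om|em] := boolP (odd (label u v)).
    suff -> : f u = f v by [].
    rewrite /f; congr (if _ then _ else _).
    by apply: (same_connect_r connect_odd_sym); apply: connect1; rewrite /odd_edge uv.
  by apply: alt_prod_comm em; apply: Zp_mulgC.
move/(congr1 chi); rewrite !chiM (morphV chiM) !chif Zp_mulgC mulKg /f connect0.
by case: ifP.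
Qed.

Lemma spherical_edge U s t : spherical U -> s \in U -> t \in U -> s != t -> edge s t.
Proof.
move=> sU Us Ut st.
by apply: (@spherical_graph_edge (induced U) (exist _ s Us) (exist _ t Ut)) => //.
Qed.

Lemma spherical1 (w : G) : spherical [set w]%SET.
Proof.
have ww : w \in [set w]%SET by rewrite finset.in_set1.
pose I := induced [set w]%SET; pose r := @coxeter_rel I.
pose s : I := exist _ w ww.
have sE (t : I) : t = s.
  by apply: val_inj => /=; apply/eqP; rewrite -finset.in_set1; apply: valP.
have ss : pres_gen r s * pres_gen r s = 1 :> pres_group r.
  have := @pres_gen_rel _ r _ _ (CoxeterSquare s).
  by rewrite !big_cons !big_nil mulg1.
have sV : (pres_gen r s)^-1 = pres_gen r s by apply: (mulgI (pres_gen r s)); rewrite mulgV ss.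
apply: (sub_finite_set (B := [set 1; pres_gen r s])) => [g _|].
  elim/pres_group_ind: g => [|t g IH|t g IH]; first by left.
    by rewrite (sE t); case: IH => /= ->; [right; rewrite mulg1 | left].
  by rewrite (sE t) sV; case: IH => /= ->; [right; rewrite mulg1 | left].
by rewrite finite_setU.
Qed.

Lemma component1 (w : G) : component [set w]%SET w = [set w]%SET.
Proof.
apply/finset.setP => u; rewrite !inE.
by apply: andb_idr => /eqP ->; apply: connect0.
Qed.

Lemma irr_components1 (w : G) : irr_components [set w]%SET = [set [set w]]%SET.
Proof. by rewrite /irr_components finset.imset_set1 component1. Qed.

Lemma sph_part1 (w : G) : sph_part [set w]%SET = [set w]%SET.
Proof.
rewrite /sph_part irr_components1; apply/finset.setP => x; apply/finset.bigcupP/idP.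
  by case=> U /andP[/finset.set1P -> _].
by move=> xw; exists [set w]%SET => //; rewrite finset.in_set1 eqxx; apply/asboolP/spherical1.
Qed.

Lemma Delta_special U d : is_Delta U d -> special U d.
Proof.
case=> e _ ->; rewrite /monoid_to_group; elim: repr => [|s u IH].
  by rewrite big_nil; apply: special1.
by rewrite big_cons; apply: specialM IH; apply: special_agen; apply: valP.
Qed.

Lemma gens_conj_image X Y g x : conj_set g (gens X) = gens Y -> x \in X ->
  exists2 y, y \in Y & g * agen x * g^-1 = agen y.
Proof.
move=> XY Xx; have : gens Y (g * agen x * g^-1) by rewrite -XY; exists (agen x) => //; exists x.
by case=> y Yy e; exists y.
Qed.

Lemma gens_conj_preimage X Y g y : conj_set g (gens X) = gens Y -> y \in Y ->
  exists2 x, x \in X & g * agen x * g^-1 = agen y.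
Proof.
move=> XY Yy; have : gens Y (agen y) by exists y.
by rewrite -XY => -[_ [x Xx <-] e]; exists x.
Qed.

(* As long as the odd class of w misses nbhd c, the letter t added by an
   elementary ribbon is never c, since t is adjacent to all the current set. *)
Lemma ribbon_avoids (c w : G) W X Y g :
  (forall u, connect (@odd_edge G) w u -> u \notin nbhd c) ->
  Ribb W X Y g ->
  let in_class A := A != finset.set0 /\ {subset A <= connect (@odd_edge G) w} in
  (in_class X <-> in_class Y) /\ (in_class X -> special (~: [set c])%SET g).
Proof.
move=> avoid rib in_class.
elim: X Y g / rib => [X Y g [_ _ XY [t [_ tX]]]|X _|X Y Z g h _ [XY Xg] _ [YZ Yh]|X Y g _ [XY Xg]].
- move=> [sU [d [d' [dU d'U gE]]]]; split; first split.
  + case=> /finset.set0Pn[x Xx] XC; split.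
      by have [y Yy _] := gens_conj_image XY Xx; apply/finset.set0Pn; exists y.
    move=> y Yy; have [x' Xx' e] := gens_conj_preimage XY Yy.
    exact: connect_trans (XC _ Xx') (conj_gen_odd_connected e).
  + case=> /finset.set0Pn[y Yy] YC; split.
      by have [x Xx _] := gens_conj_preimage XY Yy; apply/finset.set0Pn; exists x.
    move=> x Xx; have [y' Yy' e] := gens_conj_image XY Xx.
    apply: connect_trans (YC _ Yy') _; rewrite connect_odd_sym.
    exact: conj_gen_odd_connected e.
  case=> /finset.set0Pn[x Xx] XC; set U := component _ t in sU dU d'U.
  have tx : t != x by apply: contraNneq tX => ->.
  (* A missing edge is an edge of the Dynkin diagram, so [t] and [x] would lie in the same component
     [U]; but [U] is spherical, hence complete. *)
  have edge_tx : edge t x.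
    apply: contraT => ntx; have tU : t \in U.
      by rewrite finset.in_set finset.setU11 connect0.
    have xU : x \in U.
      rewrite finset.in_set finset.in_setU1 Xx orbT connect1 // /dynkin_in.
      by rewrite finset.setU11 finset.in_setU1 Xx orbT /dynkin tx (negPf ntx).
    by have := spherical_edge sU tU xU tx; rewrite (negPf ntx).
  have XUc : ((t |: X) \subset ~: [set c])%SET.
    apply/fintype.subsetP => z; rewrite finset.in_setU1 finset.in_setC finset.in_set1.
    case/orP=> [/eqP ->|Xz].
      apply: contraTneq (avoid x (XC _ Xx)) => tc.
      by rewrite negbK -tc finset.in_setU1 finset.in_set edge_tx orbT.
    by apply: contraTneq (avoid z (XC _ Xz)) => ->; rewrite negbK finset.setU11.
  have UX : U \subset (t |: X)%SET.
    by apply/fintype.subsetP => z; rewrite finset.in_set => /andP[].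
  have Uc := fintype.subset_trans UX XUc.
  rewrite gE; apply: specialM.
    exact: specialV (specialS Uc (Delta_special dU)).
  apply: specialS (Delta_special d'U).
  exact: fintype.subset_trans (finset.subsetDl _ _) Uc.
- by split=> // _; apply: special1.
- split; first by rewrite XY.
  by move=> Xc; apply: specialM (Yh (XY.1 Xc)) (Xg Xc).
- by split; [rewrite XY | move=> /XY /Xg; apply: specialV].
Qed.

(** RP writes [k] as an element of the corank one subgroup times a ribbon starting at [w], and
    [ribbon_avoids] keeps this ribbon in the same subgroup. *)
Lemma conj_in_corank1 (c w : G) k : RP G ->
  (forall u, connect (@odd_edge G) w u -> u \notin nbhd c) ->
  conj_set k (special [set w]%SET) `<=` special (~: [set c])%SET ->
  special (~: [set c])%SET k.
Proof.
move=> hRP avoid /(hRP _ _ k)[_ [R [y [r [_ _ Yy rib ->]]]]].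
apply: specialM => //; rewrite sph_part1 in rib.
have [_ ] := ribbon_avoids avoid rib; apply; split.
  by apply/finset.set0Pn; exists w; rewrite finset.in_set1.
by move=> x; rewrite finset.in_set1 => /eqP ->; apply: connect0.
Qed.

End OddClasses.

(** * Visual splittings and lines in their trees *)

Section VisualTree.
Local Open Scope classical_set_scope.
Local Open Scope group_scope.
Variables (G : labelled_graph) (X Y : {set G}).
Hypothesis split_XY : visual_splitting X Y.

Local Notation A := (artin_group G).
Local Notation Z := (X :&: Y)%SET.
Local Notation T := (visual_tree X Y).

Let sX := special_subgroup X.
Let sY := special_subgroup Y.
Let sZ := special_subgroup Z.
Let amal : is_amalgam (special X) (special Y) (special Z) := proj2 split_XY.

Lemma visual_cover s : (s \in X) || (s \in Y).
Proof. by have [XYT _] := split_XY; have := finset.in_setT s; rewrite -XYT finset.in_setU. Qed.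

Lemma visual_generated (g : A) : generated (special X `|` special Y) g.
Proof.
apply: (special_min (is_subgroup_generated _)) (specialT g) => s _.
by case/orP: (visual_cover s) => [sXs|sYs]; apply: sub_generated; [left|right]; apply: special_agen.
Qed.

(** The converse of [special_amalgam]: a crossing edge would give [(uv)^m = (vu)^m], against
    [amalgam_no_braid]. *)
Lemma visual_no_edge u v : u \notin Y -> v \notin X -> ~~ edge u v.
Proof.
move=> Yu Xv; apply/negP => uv.
have Xu : u \in X by have := visual_cover u; rewrite (negPf Yu) orbF.
have Yv : v \in Y by have := visual_cover v; rewrite (negPf Xv).
have m0 : 0 < label u v by apply: leq_trans (label_ge2 uv).
apply: (amalgam_no_braid sX sY sZ amal visual_generated m0 (u := agen u) (v := agen v)).
- exact: special_agen.
- by move/special_agenE; apply/negP.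
- exact: special_agen.
- by move/special_agenE; apply/negP.
- exact: braid_pow (agen_braid uv).
Qed.

Lemma visual_line_adj (l : int -> ga_vertex T) : injective l ->
  (forall i, ga_adj (l i) (l (i + 1)%R)) ->
  forall i j, ga_adj (l i) (l j) -> (j = i + 1 \/ j = i - 1)%R.
Proof.
move=> linj ladj.
have main (i : int) (n : nat) : ga_adj (l i) (l (i + n%:Z)%R) -> n = 1%N.
  move=> adj_in.
  apply: (bs_path_adj sX sY sZ amal visual_generated (p := fun k : nat => l (i + k%:Z)%R)).
  - by move=> k _; have := ladj (i + k%:Z)%R; rewrite -GRing.addrA -PoszD addn1.
  - by move=> k _ /linj; lia.
  - by rewrite GRing.addr0.
move=> i j; have [ij|ij] := Order.TotalTheory.leP i j.
  have -> : j = (i + `|j - i|%N%:Z)%R by lia.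
  by move=> /main ->; left.
have -> : i = (j + `|i - j|%N%:Z)%R by lia.
by move=> /(@ga_adj_sym _ T) /main ->; right; lia.
Qed.

(** As the line has no chords, [g] acts on its indices by an injection with steps 1 or -1, whose
    square is a translation. *)
Lemma visual_line_square (l : int -> ga_vertex T) g : injective l ->
  (forall i, ga_adj (l i) (l (i + 1)%R)) -> ga_act g @` range l = range l ->
  exists c : int, forall i, ga_act (g * g) (l i) = l (i + c)%R.
Proof.
move=> linj ladj lg.
have /choice[s sP] i : exists j, ga_act g (l i) = l j.
  have : range l (ga_act g (l i)) by rewrite -lg; exists (l i) => //; exists i.
  by case=> j _ <-; exists j.
have sI : injective s.
  move=> i j sij; apply: linj; rewrite -[l i]ga_act1 -[l j]ga_act1 -(mulVg g) !ga_actM.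
  by rewrite !sP sij.
have [|c cP] := int_path_square sI.
  by move=> i; apply: (visual_line_adj linj ladj); rewrite -!sP; apply/ga_act_adj/ladj.
by exists c => i; rewrite ga_actM !sP cP.
Qed.

End VisualTree.

(** * From two disjoined neighbourhoods to an acylindrical splitting *)

Section Sufficiency.
Local Open Scope classical_set_scope.
Local Open Scope group_scope.
Variables (G : labelled_graph) (a b : G).
Hypotheses (hPIP : PIP G) (hRP : RP G).
Hypothesis disjoined : ~ joined_by_odd_path (nbhd a) (nbhd b).

Local Notation X := (~: [set b])%SET.
Local Notation Y := (~: [set a])%SET.
Local Notation T := (visual_tree X Y).

Let mem_nbhd (v : G) : v \in nbhd v. Proof. exact: finset.setU11. Qed.

Let ab : a != b.
Proof.
apply/eqP => e; apply: disjoined; exists a, a.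
by split; rewrite -?e ?connect0 ?mem_nbhd.
Qed.

Let nab : ~~ edge a b.
Proof.
apply/negP => e; apply: disjoined; exists b, b; split; rewrite ?connect0 ?mem_nbhd //.
by rewrite finset.in_setU1 finset.in_set e orbT.
Qed.

Let in_X (s : G) : (s \in X) = (s != b). Proof. by rewrite finset.in_setC finset.in_set1. Qed.
Let in_Y (s : G) : (s \in Y) = (s != a). Proof. by rewrite finset.in_setC finset.in_set1. Qed.

Lemma corank1_splitting : visual_splitting X Y.
Proof.
apply: special_amalgam => [|u v].
  apply/finset.setP => s; rewrite finset.in_setU in_X in_Y finset.in_setT.
  by case: (eqVneq s b) => //= ->; rewrite eq_sym ab.
by rewrite in_X in_Y !negbK => /eqP -> /eqP ->.
Qed.

Lemma odd_class_avoids (w : G) :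
  (forall u, connect (@odd_edge G) w u -> u \notin nbhd a) \/
  (forall u, connect (@odd_edge G) w u -> u \notin nbhd b).
Proof.
case: (pselect (exists2 u, connect (@odd_edge G) w u & u \in nbhd a)) => [[u wu ua]|n].
  right=> v wv; apply/negP => vb; apply: disjoined; exists u, v; split=> //.
  by apply: connect_trans wv; rewrite connect_odd_sym.
by left=> u wu; apply/negP => ua; apply: n; exists u.
Qed.

(** By [conj_in_corank1], both [x^-1 g] and [y^-1 g] lie in the corank one subgroup. *)
Lemma corank1_cosets_eq (c w : G) x y g :
  (forall u, connect (@odd_edge G) w u -> u \notin nbhd c) ->
  conj_set g (special [set w]%SET) `<=` conj_set x (special (~: [set c])%SET) ->
  conj_set g (special [set w]%SET) `<=` conj_set y (special (~: [set c])%SET) ->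
  coset_of (special (~: [set c])%SET) x = coset_of (special (~: [set c])%SET) y.
Proof.
move=> av /conj_setV /(conj_in_corank1 hRP av) xg /conj_setV /(conj_in_corank1 hRP av) yg.
apply/(coset_of_eq _ _ (special_subgroup _)).
have -> : x^-1 * y = (x^-1 * g) * (y^-1 * g)^-1 by rewrite invgM invgK mulgA mulgK.
exact: specialM xg (specialV yg).
Qed.

(** Length 3 is the least that provides two vertices of each type, so a contradiction arises
    whichever neighbourhood the odd class of [w] avoids. *)
Lemma corank1_stabiliser n p : 3 <= n -> edge_path (T := T) n p ->
  path_stabiliser n p `<=` [set 1].
Proof.
move=> n3 [padj pinj] k kP.
have [C [C' [D [D' [CC' DD' kC [kC' kD kD']]]]]] :
    exists (C C' : left_cosets (special X)) (D D' : left_cosets (special Y)),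
    [/\ C <> C', D <> D', lcoset_act k C = C &
     [/\ lcoset_act k C' = C', lcoset_act k D = D & lcoset_act k D' = D']].
  have := padj 0 (ltnW (ltnW n3)); have := padj 1%N (ltnW n3); have := padj 2 n3.
  have p02 : p 0 <> p 2 by move=> e; have := pinj 0 2 isT (ltnW n3) e.
  have p13 : p 1%N <> p 3 by move=> e; have := pinj 1%N 3 (ltnW (ltnW n3)) n3 e.
  have := kP 0 (leq0n _); have := kP 1%N (ltnW (ltnW n3)).
  have := kP 2 (ltnW n3); have := kP 3 n3; move: p02 p13.
  case: (p 0) => C0; case: (p 1%N) => C1 //; case: (p 2) => C2 //; case: (p 3) => C3 //=;
    move=> p02 p13 [k3] [k2] [k1] [k0] _ _ _.
    exists C0, C2, C1, C3; split; [|..|split] => //; try exact: left_cosets_inj.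
      by move=> e; apply: p02; rewrite e.
    by move=> e; apply: p13; rewrite e.
  exists C1, C3, C0, C2; split; [|..|split] => //; try exact: left_cosets_inj.
    by move=> e; apply: p13; rewrite e.
  by move=> e; apply: p02; rewrite e.
have [x Cx] := coset_ofP C; have [x' Cx'] := coset_ofP C'.
have [y Dy] := coset_ofP D; have [y' Dy'] := coset_ofP D'.
pose Q := (conj_set x (special X) `&` conj_set x' (special X)) `&`
          (conj_set y (special Y) `&` conj_set y' (special Y)).
have [g [W QW]] : parabolic Q.
  by apply: hPIP; apply: hPIP; [exists x, X | exists x', X | exists y, Y | exists y', Y].
have sX := special_subgroup X; have sY := special_subgroup Y.
have : Q k.
  split; split; [exact: coset_stabiliser sX Cx kC | exact: coset_stabiliser sX Cx' kC'
    | exact: coset_stabiliser sY Dy kD | exact: coset_stabiliser sY Dy' kD'].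
rewrite QW; have [->|/finset.set0Pn[w Ww]] := eqVneq W finset.set0.
  by case=> h /special0 -> <- /=; rewrite mulg1 mulgV.
have wQ : conj_set g (special [set w]%SET) `<=` Q.
  rewrite QW => _ [h hw <-]; exists h => //; apply: specialS hw.
  by rewrite finset.sub1set.
have [av|av] := odd_class_avoids w; exfalso.
  apply: DD'; rewrite Dy Dy'.
  by apply: (corank1_cosets_eq av) => h /wQ [_ []].
apply: CC'; rewrite Cx Cx'.
by apply: (corank1_cosets_eq av) => h /wQ [[]].
Qed.

Lemma corank1_nonelementary : nonelementary_acylindrical T.
Proof.
split.
- exists 3, 1%N; split=> // n p n3 np.
  apply: card_le_trans (subset_card_le (corank1_stabiliser n3 np)) _.
  by have /card_eqPle[] := @card_set1 _ (1 : artin_group G).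
- have fixed (c : G) C : ~ forall g : artin_group G,
      lcoset_act g C = C :> left_cosets (special (~: [set c])%SET).
    move=> fix_C; have [x Cx] := coset_ofP C.
    (* The stabiliser of the coset of [x] does not contain the conjugate [x c x^-1]. *)
    have [h Hh e] := coset_stabiliser (special_subgroup _) Cx (fix_C (x * agen c * x^-1)).
    move: e => /mulIg/mulgI e; move: Hh; rewrite e => /special_agenE.
    by rewrite finset.in_setC finset.in_set1 eqxx.
  by case=> -[C|D] fx; [apply: (fixed b C) => g | apply: (fixed a D) => g]; case: (fx g).
(* On an invariant line the squares of [a] and [b] act by translations, which commute. Their
   commutator then fixes a path of length 3, so it is trivial. *)
- case=> l [linj ladj lG]; have split_XY := corank1_splitting.
  have [ca aP] := visual_line_square split_XY linj ladj (lG (agen a)).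
  have [cb bP] := visual_line_square split_XY linj ladj (lG (agen b)).
  apply: (agen_sq_noncomm ab nab); set g := agen a ^+ 2; set h := agen b ^+ 2.
  have : [set 1] ((h * g)^-1 * (g * h)).
    apply: (@corank1_stabiliser 3 (fun i : nat => l (Posz i))) => //.
      split=> [i _|i j _ _ /linj []//]; by have := ladj (Posz i); rewrite -PoszD addn1.
    move=> i _.
    have gP j : @ga_act _ T g (l j) = l (j + ca)%R by apply: aP.
    have hP j : @ga_act _ T h (l j) = l (j + cb)%R by apply: bP.
    have gh : ga_act (g * h) (l (Posz i)) = ga_act (h * g) (l (Posz i)).
      rewrite (ga_actM g h) (ga_actM h g) gP hP gP hP -!GRing.addrA.
      by rewrite (GRing.addrC ca).
    rewrite (ga_actM (h * g)^-1 (g * h)) gh -(ga_actM (h * g)^-1 (h * g)).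
    by rewrite mulVg ga_act1.
  by move=> /(congr1 (fun t => h * g * t)); rewrite mulVKg mulg1.
Qed.

End Sufficiency.

(** * From odd paths to infinite path stabilisers *)

Section Necessity.
Local Open Scope classical_set_scope.
Local Open Scope group_scope.
Variables (G : labelled_graph) (X Y : {set G}).
Hypothesis split_XY : visual_splitting X Y.
Local Notation Z := (X :&: Y)%SET.
Local Notation T := (visual_tree X Y).

Let sX := special_subgroup X.
Let sY := special_subgroup Y.
Let sZ := special_subgroup Z.
Let amal : is_amalgam (special X) (special Y) (special Z) := proj2 split_XY.

Lemma edge_rot_commute (x u : G) : edge x u ->
  agen u * (agen x * agen u) ^+ label x u = (agen x * agen u) ^+ label x u * agen u.
Proof.
move=> xu; have e := agen_braid xu.
by rewrite (braid_pow e); apply: braid_pow_commute; rewrite e.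
Qed.

(** For [u] in [X :&: Y], such elements from both sides are the letters of an alternating walk fixed
    by [u]. *)
Definition centralised (A B : {set G}) (u : G) : Prop :=
  exists h, [/\ special A h, ~ special B h & agen u * h = h * agen u].

(** The power [(xu)^m] commutes with [u], and [special_rot_pow] keeps it out of [A_B]. *)
Lemma edge_centralised (A B : {set G}) (x u : G) :
  edge x u -> x \in A -> u \in A -> x \notin B -> centralised A B u.
Proof.
move=> xu Ax Au Bx; exists ((agen x * agen u) ^+ label x u); split.
- by apply: specialX; apply: specialM; apply: special_agen.
- by move/(special_rot_pow xu); apply/negP.
- exact: edge_rot_commute.
Qed.

(** The alternating product of [u] and [v] conjugates one into the other and lies in both special
    subgroups, so conjugating [h] by it preserves membership and non-membership. *)
Lemma odd_edge_centralised (A B : {set G}) (u v : G) : odd_edge u v ->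
  u \in A -> u \in B -> v \in A -> v \in B -> centralised A B u -> centralised A B v.
Proof.
move=> /andP[uv om] Au Bu Av Bv [h [Ah nBh uh]].
set d := alt_prod (label u v) (agen u) (agen v).
have dE : agen u * d = d * agen v := braid_odd_conj (agen_braid uv) om.
have Ad : special A d by apply: special_alt_prod; apply: special_agen.
have Bd : special B d by apply: special_alt_prod; apply: special_agen.
exists (d^-1 * h * d); split.
- by apply: specialM => //; apply: specialM => //; apply: specialV.
- move=> Bh; apply: nBh; have -> : h = d * (d^-1 * h * d) * d^-1.
    by rewrite !mulgA mulgV mul1g mulgK.
  by apply: specialM (specialV Bd); apply: specialM.
- have -> : agen v = d^-1 * agen u * d by rewrite -mulgA dE mulKg.
  by rewrite !mulgA !mulgK -!(mulgA d^-1) uh !mulgA.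
Qed.

(** The powers of [u], infinitely many by [agen_pow_inj], all fix the walk with alternating letters
    [h1] and [h2], whatever its length. *)
Lemma centralised_not_acylindrical u :
  centralised X Y u -> centralised Y X u -> u \in Z -> ~ acylindrical T.
Proof.
move=> [h1 [Xh1 nYh1 uh1]] [h2 [Yh2 nXh2 uh2]] Zu [k [C [_ stab_le]]].
pose l i := if odd i then h2 else h1.
have lP n i : i < n -> alt_side (special X) (special Y) i (l i) /\
    ~ alt_side (special X) (special Y) i.+1 (l i).
  by move=> _; rewrite /alt_side /l /=; case: (odd i).
have := stab_le k _ (leqnn k)
  (alt_path_edge_path sX sY sZ amal (visual_generated split_XY) (lP k)).
set S := path_stabiliser _ _ => le_SC.
have comm i j : agen u ^+ j * \prod_(t < i) l t = \prod_(t < i) l t * agen u ^+ j.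
  have ul : commute (agen u) (\prod_(t < i) l t).
    elim: i => [|i IH]; first by rewrite big_ord0; apply: commute1.
    by rewrite big_ord_recr; apply: commuteM IH _; rewrite /l; case: (odd i).
  by apply: commute_sym; apply: commuteX; apply: commute_sym.
have uS j : S (agen u ^+ j).
  move=> i _; rewrite /alt_path /alt_vertex.
  have [Xu Yu] : u \in X /\ u \in Y by apply/andP; rewrite -finset.in_setI.
  have fixed (A : {set G}) (C0 := coset_of (special A) (\prod_(t < i) l t)) :
      u \in A -> lcoset_act (agen u ^+ j) C0 = C0.
    move=> Au; rewrite lcoset_act_coset; apply/(coset_of_eq _ _ (special_subgroup A)).
    rewrite comm invgM -mulgA mulVg mulg1.
    exact: specialV (specialX _ (special_agen Au)).
  by case: (odd i); [congr inr | congr inl]; apply: fixed.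
have uI : {in (classical_sets.setT : set nat) &, injective (fun n => agen u ^+ n)}.
  by move=> m n _ _; apply: agen_pow_inj.
apply: infinite_nat; apply: card_le_finite (finite_II C).
apply: card_le_trans le_SC.
apply: card_le_trans (subset_card_le (_ : range (fun n => agen u ^+ n) `<=` S)).
  by have /card_eqPle[] := inj_card_eq uI.
by move=> _ [j _ <-]; apply: uS.
Qed.

Lemma odd_path_crossing (a b : G) : a \notin Y -> b \notin X ->
  joined_by_odd_path (nbhd a) (nbhd b) ->
  exists2 u, u \in Z & centralised X Y u /\ centralised Y X u.
Proof.
move=> Ya Xb [u [v [ua vb /connectP[s s_path vE]]]].
have cover := visual_cover split_XY; have no_edge := visual_no_edge split_XY.
have inX x : x \notin Y -> x \in X by have := cover x; case: (x \in X) => //= ->.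
have inY x : x \notin X -> x \in Y by have := cover x; case: (x \in X).
(* Invariant along the odd path: the vertex is still outside [Y], or it is in [Z] with a
   centralising element of [A_X] already found. A step from there out of [X] supplies the element of
   [A_Y]. *)
pose left_side x := x \notin Y \/ (x \in Z /\ centralised X Y x).
have step_out x y : edge x y -> x \notin Y -> left_side y.
  move=> xy Yx; have Xy : y \in X.
    by apply: contraT => Xy; have := no_edge x y Yx Xy; rewrite xy.
  have [Yy|Yy] := boolP (y \in Y); [right|by left].
  by split; [rewrite finset.in_setI Xy | apply: (edge_centralised xy (inX x Yx))].
have step_in x y : edge x y -> left_side x -> y \notin X ->
    exists2 t, t \in Z & centralised X Y t /\ centralised Y X t.
  move=> xy [Yx|[Zx cx]] Xy; first by have := no_edge x y Yx Xy; rewrite xy.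
  have [Xx Yx] : x \in X /\ x \in Y by apply/andP; rewrite -finset.in_setI.
  rewrite edge_sym in xy; exists x => //; split=> //.
  exact: (edge_centralised xy (inY y Xy)).
have left_u : left_side u.
  move: ua; rewrite finset.in_setU1 finset.in_set => /orP[/eqP ->|au]; first by left.
  exact: step_out au Ya.
have [left_v|//] : left_side v \/ exists2 t, t \in Z & centralised X Y t /\ centralised Y X t.
  rewrite vE; elim: s u left_u s_path {vE ua} => [|y s IH] x lx /=; first by left.
  case/andP=> xy s_path; have [exy oxy] := andP xy.
  have [Xy|Xy] := boolP (y \in X); last by right; apply: step_in exy lx Xy.
  apply: IH s_path; have [Yy|Yy] := boolP (y \in Y); last by left.
  case: lx => [Yx|[Zx cx]]; first exact: step_out exy Yx.
  have [Xx Yx] : x \in X /\ x \in Y by apply/andP; rewrite -finset.in_setI.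
  by right; split; [rewrite finset.in_setI Xy | apply: (odd_edge_centralised xy)].
(* Ending at [b] itself contradicts the invariant; otherwise the edge from the endpoint to [b] is
   the step out of [X]. *)
move: vb; rewrite finset.in_setU1 finset.in_set => /orP[/eqP vb|bv].
  case: left_v => [Yv|[]]; first by move: (inY _ Xb); rewrite -vb (negPf Yv).
  by rewrite vb finset.in_setI (negPf Xb).
by apply: (step_in v b) => //; rewrite edge_sym.
Qed.

Lemma nonelementary_disjoined : nonelementary_acylindrical T ->
  exists a b : G, ~ joined_by_odd_path (nbhd a) (nbhd b).
Proof.
move=> [acyl nofix _].
have proper (A : {set G}) : (forall s, s \in A) -> forall g, special A g.
  by move=> AT g; apply: specialS (specialT g); apply/fintype.subsetP => s _.
(* If [Y] contained every vertex, its base coset would be a global fixed point. *)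
have [a Ya] : exists a, a \notin Y.
  apply: contrapT => nY; apply: nofix; exists (inr (coset_of (special Y) 1)) => g /=.
  rewrite lcoset_act_coset; congr inr; apply/(coset_of_eq _ _ sY); apply: proper => s.
  by apply: contraT => Ys; case: nY; exists s.
have [b Xb] : exists b, b \notin X.
  apply: contrapT => nX; apply: nofix; exists (inl (coset_of (special X) 1)) => g /=.
  rewrite lcoset_act_coset; congr inl; apply/(coset_of_eq _ _ sX); apply: proper => s.
  by apply: contraT => Xs; case: nX; exists s.
exists a, b => /(odd_path_crossing Ya Xb)[u Zu [cX cY]].
exact: centralised_not_acylindrical cX cY Zu acyl.
Qed.

End Necessity.

Theorem corollary1p5 (G : labelled_graph) (hPIP : PIP G) (hRP : RP G) :
  (exists X Y : {set G},
     visual_splitting X Y /\ nonelementary_acylindrical (visual_tree X Y)) <->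
  (exists a b : G, ~ joined_by_odd_path (nbhd a) (nbhd b)).
Proof.
split=> [[X [Y [split_XY nonel]]]|[a [b nab]]].
  exact: nonelementary_disjoined split_XY nonel.
exists (~: [set b])%SET, (~: [set a])%SET.
by split; [apply: corank1_splitting | apply: corank1_nonelementary].
Qed.
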